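(* Let $X$ be an inhomogeneous Poisson process with state-dependent rate $\lambda$ and $X_0=x_0$, let $x_T>x_0$, and let $X^\star=(X\mid X_T=x_T)$. Let $X^\circ$ be the guided process induced by $$\tilde h(t,x)=\begin{cases}\dfrac{(\tilde\lambda(T-t))^{x_T-x}}{(x_T-x)!}e^{-\tilde\lambda(T-t)},&(t,x)\in[0,T)\times\{x_0,\dots,x_T\},\\ 0&\text{elsewhere},\end{cases}$$ and suppose that $\tilde\lambda\le\min\{\lambda(x):x\in\{x_0,\dots,x_T\}\}$. Then the laws $\mathbb{P}^\star_T$ of $X^\star$ and $\mathbb{P}^\circ_T$ of $X^\circ$ are equivalent on $[0,T]$. Moreover, $$\frac{\mathrm{d}\mathbb{P}^\star_T}{\mathrm{d}\mathbb{P}^\circ_T}(X)=\frac{\tilde h(0,x_0)}{h(0,x_0)}\exp\Big(\int_0^T\big[\lambda(X_s)-\tilde\lambda\big]\Big[\frac{x_T-X_s}{\tilde\lambda(T-s)}-1\Big]\mathrm{d}s\Big),$$ where $h(t,x)=\mathbb{P}(X_T=x_T\mid X_t=x)$.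
   Context: $T>0$; $x_0<x_T$ are integers; $\tilde\lambda>0$ is a constant. The process $X$ is the integer-valued Markov jump process with $X_0=x_0$, $\mathbb{P}(X_{t+\Delta}=x+1\mid X_t=x)=\lambda(x)\Delta+o(\Delta)$, i.e. with generator $\mathcal{L}f(x)=\lambda(x)(f(x+1)-f(x))$; $\lambda$ is assumed to take finite (nonnegative) values on $\{x_0,\dots,x_T\}$. $\mathcal{A}=\frac{\partial}{\partial t}+\mathcal{L}$, $\mathcal{F}_t=\sigma(X_s:s\le t)$, $\mathbb{P}_t=\mathbb{P}|_{\mathcal{F}_t}$. The guided process induced by $\tilde h$ is $X$ under the law $\mathbb{P}^\circ$ given for $t<T$ by $$\frac{\mathrm{d}\mathbb{P}^\circ_t}{\mathrm{d}\mathbb{P}_t}=\frac{\tilde h(t,X_t)}{\tilde h(0,x_0)}\exp\Big(-\int_0^t\frac{\mathcal{A}\tilde h}{\tilde h}(s,X_s)\,\mathrm{d}s\Big),$$ this density being $0$ when $X_t>x_T$. Equivalently, $X^\circ$ is a jump process on $\{x_0,\dots,x_T\}$ started at $x_0$ which jumps from $x$ to $x+1$ at time $t$ with rate $\lambda(x)\tilde h(t,x+1)/\tilde h(t,x)=\lambda(x)\frac{x_T-x}{\tilde\lambda(T-t)}$ for $x<x_T$ and rate $0$ at $x_T$. $\mathbb{P}^\star$ is the analogous change of measure with $h$ (for which $\mathcal{A}h=0$), i.e. the law of $X$ conditioned on $X_T=x_T$. $\mathbb{P}^\star_T,\mathbb{P}^\circ_T$ denote the laws on the full interval $[0,T]$,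 determined by their restrictions to $\mathcal{F}_t$, $t<T$. *)

(* Defs.v *)
From HB Require Import structures.
From mathcomp Require Import all_boot all_order all_algebra.
From mathcomp Require Import all_classical all_reals all_analysis.

Set Implicit Arguments.
Unset Strict Implicit.
Unset Printing Implicit Defensive.

Import Order.TTheory GRing.Theory Num.Theory.
Import numFieldNormedType.Exports.

Local Open Scope classical_set_scope.
Local Open Scope ring_scope.
Local Open Scope charge_scope.

HB.instance Definition _ := isPointed.Build int 0.

HB.instance Definition _ := @isMeasurable.Build default_measure_display
  int discrete_measurable discrete_measurable0
  discrete_measurableC discrete_measurableU.

Section restriction_to_sub_sigma_algebra.
Context d (Omega : measurableType d) (R : realType).
Variables (P : probability Omega R) (G : set (set Omega)).
Hypothesis sG : <<s G>> `<=` (@measurable d Omega).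

(* sG is an argument only so that the measure instances below can be inferred. *)
Definition sigma_restr : set (g_sigma_algebraType G) -> \bar R :=
  let _ := sG in P.

Let sigma_restr0 : sigma_restr set0 = 0%E.
Proof. exact: measure0. Qed.

Let sigma_restr_ge0 A : (0 <= sigma_restr A)%E.
Proof. exact: measure_ge0. Qed.

Let sigma_restr_sigma_additive : semi_sigma_additive sigma_restr.
Proof.
move=> F mF tF mUF; apply: (@measure_semi_sigma_additive _ _ _ P F) => //.
- by move=> i; apply: sG; exact: mF.
- exact: sG.
Qed.

HB.instance Definition _ := isMeasure.Build _ _ _ sigma_restr
  sigma_restr0 sigma_restr_ge0 sigma_restr_sigma_additive.

Let sigma_restrT : sigma_restr [set: Omega] = 1%E.
Proof. exact: probability_setT. Qed.

HB.instance Definition _ :=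
  Measure_isProbability.Build _ _ _ sigma_restr sigma_restrT.

End restriction_to_sub_sigma_algebra.

Section process.
Context d (Omega : measurableType d) (R : realType).
(* Only the times t >= 0 matter. *)
Variable X : R -> {mfun Omega >-> int}.

(* A generating family of F_t = sigma(X_s : 0 <= s <= t). *)
Definition past (t : R) : set (set Omega) :=
  \bigcup_(s in `[0, t]) preimage_set_system setT (X s) measurable.

Lemma past_measurable (t : R) : <<s past t >> `<=` (@measurable d Omega).
Proof.
apply: smallest_sub; first exact: sigma_algebra_measurable.
move=> _ [s _ [B mB <-]]; exact: measurable_funP.
Qed.

Definition on_past (P : probability Omega R) (t : R) :
    probability (g_sigma_algebraType (past t)) R :=
  sigma_restr P (past_measurable (t := t)).

Lemma measurable_state (t : R) (x : int) : measurable (X t @^-1` [set x]).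
Proof. by rewrite -[X in measurable X]setTI; exact: measurable_funP. Qed.

(* The law of X given X_T = x_T, that is A |-> P(A | X_T = x_T). The last
   argument of mnormalize is a default for the case P(X_T = x_T) = 0. *)
Definition conditioned (P : probability Omega R) (T : R) (xT : int) :
    probability Omega R :=
  mnormalize (mrestr P (measurable_state T xT)) P.

Definition generator (lambda : int -> R) (f : int -> R) (x : int) : R :=
  lambda x * (f (x + 1) - f x).

(* X is the pure-birth Markov jump process with rate lambda started at x0:
   paths are cadlag for the discrete topology on int, and X is a time-homogeneous
   Markov process whose transition function p satisfies
   p u x y = 1_{x = y} + u * (L 1_y)(x) + o(u) as u -> 0+, that is,
   p u x (x + 1) = lambda x * u + o(u) and p u x x = 1 - lambda x * u + o(u). *)
Record jump_process (P : probability Omega R) (lambda : int -> R) (x0 : int) :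
    Prop := {
  jump_start : P (X 0 @^-1` [set x0]) = 1%E ;
  jump_right : forall w t, 0 <= t -> \forall s \near t^'+, X s w = X t w ;
  jump_left : forall w t, 0 < t ->
    exists x, \forall s \near t^'-, X s w = x ;
  jump_markov : exists p : R -> int -> int -> R,
    (forall s u A x y, 0 <= s -> 0 <= u -> <<s past s >> A ->
       P (A `&` X s @^-1` [set x] `&` X (s + u) @^-1` [set y]) =
       (P (A `&` X s @^-1` [set x]) * (p u x y)%:E)%E) /\
    (forall x y,
       (p u x y - (x == y)%:R) / u @[u --> 0^'+] -->
       generator lambda (fun z => (z == y)%:R) x) }.

(* h(t,x) = P(X_T = x_T | X_t = x), with value 0 if P(X_t = x) = 0 *)
Definition hitting (P : probability Omega R) (T : R) (xT : int)
    (t : R) (x : int) : R :=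
  fine (P (X T @^-1` [set xT] `&` X t @^-1` [set x])) /
  fine (P (X t @^-1` [set x])).

Definition htilde (T tlambda : R) (x0 xT : int) (t : R) (x : int) : R :=
  if (0 <= t < T) && (x0 <= x <= xT) then
    (tlambda * (T - t)) ^+ `|xT - x|%N / (`|xT - x|%N)`!%:R *
    expR (- (tlambda * (T - t)))
  else 0.

(* The operator A = d/dt + L *)
Definition space_time (lambda : int -> R) (f : R -> int -> R)
    (t : R) (x : int) : R :=
  derive1 (fun s => f s x) t + generator lambda (f t) x.

(* The density of the law guided by g with respect to P on F_t; it vanishes
   where g t (X t w) = 0. *)
Definition guiding_density (lambda : int -> R) (g : R -> int -> R) (x0 : int)
    (t : R) (w : Omega) : R :=
  g t (X t w) / g 0 x0 *
  expR (- \int[lebesgue_measure]_(s in `[0, t])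
            (space_time lambda g s (X s w) / g s (X s w))).

(* Pcirc is the law on F_T of the process guided by g. The densities determine
   Pcirc on each F_t with t < T, hence on sigma(X_s : s < T); the value at time T
   is the left limit. *)
Definition guided (P : probability Omega R) (lambda : int -> R)
    (g : R -> int -> R) (x0 : int) (T : R) (Pcirc : probability Omega R) :
    Prop :=
  (forall t, 0 <= t < T ->
     on_past Pcirc t `<< on_past P t /\
     ae_eq (on_past P t) setT
       ('d (charge_of_finite_measure (on_past Pcirc t)) '/d (on_past P t))
       (fun w => (guiding_density lambda g x0 t w)%:E)) /\
  {ae Pcirc, forall w, \forall s \near T^'-, X s w = X T w}.

End process.

(* Main.v *)
Require Import Defs.
From mathcomp Require Import all_boot all_order all_algebra.
From mathcomp Require Import all_classical all_reals all_analysis.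
From mathcomp Require Import measurable_realfun ring lra.

Set Implicit Arguments.
Unset Strict Implicit.
Unset Printing Implicit Defensive.

Import Order.TTheory GRing.Theory Num.Theory.
Import numFieldNormedType.Exports.

Local Open Scope classical_set_scope.
Local Open Scope ring_scope.
Local Open Scope charge_scope.

(** Let h(t,x) be the probability of reaching xT at time T from x at time t.
By the Markov property the conditioned law P* has density H_t = h(t,X_t) /
P(X_T = xT) with respect to P on the past of t, while the guided law has
density D_t with respect to P there. Hence, for t < T, the guided law has
density D_t / H_t with respect to P* on the past of t (density_quotient), and
the proof consists in letting t tend to T in this quotient rather than in its
inverse, because this quotient stays bounded.

Two facts give the bound. A direct computation (space_time_htilde) shows that,
for x in the range from x0 to xT, (A htilde / htilde)(s,x) is (lambda(x) -
tlambda) ((xT - x) / (tlambda (T - s)) - 1), which is bounded below because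
tlambda <= lambda: the singular term has a favourable sign, and the
exponential factor of D_t is bounded above (integral_guiding_rate_ge).
Moreover, moving from x to xT takes xT - x jumps, and splitting a short time u
into pieces, one for each jump, gives P(x -> xT in time u) >= c u ^ (xT - x)
(transition_lower_bound), which has the same order as htilde; so htilde / h is
bounded near T (htilde_le_hitting).

The infinitesimal description of the transition function also shows that,
under P*, the probability of X_t = x tends to 0 as t -> T for each x <> xT.
Since paths are eventually constant to the left of T, X_t = xT for t close to
T, almost surely under P*, and by the bound above also under the guided law.
On this event h(t,X_t) and htilde(t,X_t) tend to 1, the integral of A htilde /
htilde converges, and D_t / H_t has the positive limit y = P(X_T = xT) /
htilde(0,x0) exp(- integral of A htilde / htilde over [0,T]).

Bounded convergence and the pi-lambda theorem then identify y as the density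
of the guided law with respect to P* on the whole past of T. As y > 0, the
laws are equivalent and the reverse density is 1 / y (density_limit). Under
the guided law the path stays in the range from x0 to xT, so that y is given
by the integral of the theorem. *)

(** * Quotients of densities *)

Section change_of_density.
Context d (S : measurableType d) (R : realType).
Variables (P Pc Ps : probability S R) (H D : S -> R).
Hypothesis mH : measurable_fun setT H.
Hypothesis H0 : forall w, 0 <= H w.
Hypothesis PsH : forall A, measurable A ->
  Ps A = (\int[P]_(w in A) (H w)%:E)%E.
Hypothesis PcP : Pc `<< P.
Hypothesis PcD :
  ae_eq P setT ('d (charge_of_finite_measure Pc) '/d P) (EFin \o D).
Hypothesis HD : forall w, H w = 0 -> D w = 0.

Let mEH : measurable_fun setT (fun w => (H w)%:E).
Proof. exact/measurable_EFinP. Qed.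

Lemma density_dominates : Ps `<< P.
Proof.
apply/null_content_dominatesP => A mA PA0.
by rewrite PsH// null_set_integral//; exact: measurable_funTS.
Qed.

(** A set that is null for the law with density H carries H = 0, hence D = 0. *)
Lemma dominates_density : Pc `<< Ps.
Proof.
apply/null_content_dominatesP => A mA PsA0.
have : ae_eq P A (EFin \o H) (cst 0%E).
  apply/(ae_eq_integral_abs P mA); first exact: measurable_funTS.
  transitivity (Ps A); last by [].
  rewrite PsH//; apply: eq_integral => w _ /=.
  by rewrite ger0_norm.
move=> HA0.
have -> : Pc A =
    (\int[P]_(w in A) ('d (charge_of_finite_measure Pc) '/d P) w)%E.
  exact: (@Radon_Nikodym_integral _ _ _ (charge_of_finite_measure Pc)).
rewrite (@ae_eq_integral _ _ _ P A (cst 0%E))// ?integral0//.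
  by apply: measurable_funTS; exact: measurable_int
    (@Radon_Nikodym_integrable _ _ _ (charge_of_finite_measure Pc) _ PcP).
apply: filterS2 HA0 PcD => w /= HA0 PcDw Aw.
rewrite PcDw//= HD//.
by have [] := HA0 Aw.
Qed.

(** Chain rule: dPc/dP = (dPc/dPs) (dPs/dP), where dPs/dP = H does not vanish
    almost everywhere for Ps. *)
Lemma density_quotient :
  ae_eq Ps setT ('d (charge_of_finite_measure Pc) '/d Ps)
    (fun w => (D w / H w)%:E).
Proof.
have PsP := density_dominates; have PcPs := dominates_density.
have HE : ae_eq P setT ('d (charge_of_finite_measure Ps) '/d P) (EFin \o H).
  apply: integral_ae_eq => //; first exact: Radon_Nikodym_integrable.
  by move=> A _ mA; rewrite -Radon_Nikodym_integral//= -PsH.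
have H_pos : {ae Ps, forall w, 0 < H w}.
  have mH0 : measurable (H @^-1` [set 0]).
    by rewrite -[X in measurable X]setTI; exact: mH.
  exists (H @^-1` [set 0]); split => //.
    rewrite PsH//; apply: integral0_eq => w /= ->//.
  by move=> w /= /negP; rewrite lt_def H0 andbT negbK => /eqP.
have chain : ae_eq P setT ('d (charge_of_finite_measure Pc) '/d P)
    ('d (charge_of_finite_measure Pc) '/d Ps \*
     'd (charge_of_finite_measure Ps) '/d P)%E.
  exact: (Radon_Nikodym_chain_rule (mu := Ps)).
have chain' := null_dominates_ae_eq measurableT PsP chain.
have HE' := null_dominates_ae_eq measurableT PsP HE.
have PcD' := null_dominates_ae_eq measurableT PsP PcD.
apply: filterS3 (filterI H_pos PcD') HE' chain'.
move=> w [Hw /(_ I) Dw] /(_ I) HEw /(_ I) + _.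
rewrite Dw /= HEw /=.
have /fineK <- :=
  @Radon_Nikodym_fin_num _ _ _ (charge_of_finite_measure Pc) _ w PcPs.
rewrite -EFinM => -[->]; rewrite mulfK ?gt_eqF//.
Qed.

End change_of_density.

(** * Passing to the limit in a sequence of densities *)

Lemma Radon_Nikodym_self d (S : measurableType d) (R : realType)
    (P : probability S R) :
  ae_eq P setT ('d (charge_of_finite_measure P) '/d P) (cst 1%E).
Proof.
apply: integral_ae_eq => //.
- by apply: (@Radon_Nikodym_integrable _ _ _ (charge_of_finite_measure P)).
- move=> A _ mA; rewrite integral_cst// mul1e.
  by rewrite -(@Radon_Nikodym_integral _ _ _ (charge_of_finite_measure P)).
Qed.

Section density_limit.
Context d (S : measurableType d) (R : realType).
Variables (Pc Ps : probability S R) (G : set (set S)).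
Variables (E : nat -> S -> \bar R) (y : S -> R) (C : R).
Hypothesis sG : (@measurable d S) = <<s G>>.
Hypothesis IG : setI_closed G.
Hypothesis GT : G setT.
Hypothesis mE : forall k, measurable_fun setT (E k).
Hypothesis PcE : forall A, G A ->
  \forall k \near \oo, Pc A = (\int[Ps]_(w in A) E k w)%E.
Hypothesis E_bnd : {ae Ps, forall w, forall k, (`|E k w| <= C%:E)%E}.
Hypothesis E_cvg : {ae Ps, forall w, E k w @[k --> \oo] --> (y w)%:E}.
Hypothesis y_gt0 : {ae Ps, forall w, 0 < y w}.

(** The limit y may fail to be measurable; the upper limit of the densities is
    a measurable function that equals y almost everywhere. *)
Let f w := limn_esup (E ^~ w).

Let mf : measurable_fun setT f.
Proof. exact: measurable_fun_limn_esup. Qed.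

Let fE : {ae Ps, forall w, f w = (y w)%:E}.
Proof.
apply: filterS E_cvg => w Ew.
by rewrite /f is_cvg_limn_esupE; [exact: cvg_lim | apply/cvg_ex; eexists; exact: Ew].
Qed.

Let f_gt0 : {ae Ps, forall w, (0 < f w)%E}.
Proof. by apply: filterS2 fE y_gt0 => w -> /=; rewrite lte_fin. Qed.

Let f_dom A : measurable A -> [/\ Ps.-integrable A f,
  [sequence \int[Ps]_(x in A) `|E k x - f x|]_k @ \oo --> 0 &
  [sequence \int[Ps]_(x in A) E k x]_k @ \oo --> \int[Ps]_(x in A) f x]%E.
Proof.
move=> mA; apply: (@dominated_convergence _ _ _ _ _ _ E f (cst C%:E)) => //.
- by move=> k; exact: measurable_funTS.
- exact: measurable_funTS.
- by apply: filterS2 fE E_cvg => w -> + _.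
- apply/integrableP; split => //.
  rewrite integral_cst//= lte_mul_pinfty//.
  by rewrite ltey_eq fin_num_measure.
- by apply: filterS E_bnd => w + k _; exact.
Qed.

Let intf : Ps.-integrable setT f.
Proof. by have [] := f_dom measurableT. Qed.

Let GPc A : G A -> Pc A = (\int[Ps]_(w in A) f w)%E.
Proof.
move=> GA; have mA : measurable A by rewrite sG; exact: sub_sigma_algebra.
have [_ _ cv] := f_dom mA.
rewrite -(cvg_lim _ cv)//; apply/esym/cvg_lim => //.
by apply: cvg_near_cst; apply: filterS (PcE GA) => k ->.
Qed.

(** Both sides are finite and sigma-additive in A, so that agreement on the
    generating pi-system suffices; the right-hand side is treated as a charge. *)
Let PcfE A : measurable A -> Pc A = (\int[Ps]_(w in A) f w)%E.
Proof.
rewrite {1}sG => sA.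
pose nu : {charge set S -> \bar R} := induced_charge intf.
suff: Pc A = nu A by [].
move: A sA; apply: (dynkin_induction sG IG) => /=.
- exact: (GPc GT).
- by move=> A GA; exact: (GPc GA).
- move=> A mA PcA.
  rewrite -setTD measureD//; last by rewrite ltey_eq fin_num_measure.
  rewrite chargeD// !setTI; congr (_ - _)%E; [exact: (GPc GT)|exact: PcA].
- move=> F mF tF PcF.
  have mU : measurable (\bigcup_k F k) by exact: bigcup_measurable.
  have c1 := @measure_semi_sigma_additive _ _ _ Pc F mF tF mU.
  have c2 := @charge_semi_sigma_additive _ _ _ nu F mF tF mU.
  rewrite -(cvg_lim _ c1)//; apply: cvg_lim => //.
  rewrite (_ : (fun n => _) = (fun n => \sum_(0 <= i < n) nu (F i))%E)//.
  by apply/funext => n; apply: eq_bigr => i _; exact: PcF.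
Qed.

Let limit_dominates : Pc `<< Ps.
Proof.
apply/null_content_dominatesP => A mA PsA0.
by rewrite PcfE// null_set_integral//; exact: measurable_funTS.
Qed.

Let dominates_limit : Ps `<< Pc.
Proof.
apply/null_content_dominatesP => A mA PcA0.
have : ae_eq Ps A f (cst 0%E).
  apply/(ae_eq_integral_abs Ps mA); first exact: measurable_funTS.
  transitivity (Pc A); last by [].
  rewrite PcfE//; apply: ae_eq_integral => //.
  - by apply: measurable_funTS; exact: measurableT_comp.
  - exact: measurable_funTS.
  - by apply: filterS f_gt0 => w fw _; rewrite gte0_abs.
move=> f0; apply/negligibleP => //.
have : {ae Ps, forall w, ~ A w}.
  by apply: filterS2 f0 f_gt0 => w /= + + Aw => /(_ Aw) ->; rewrite ltxx.
by apply: negligibleS => w Aw /(_ Aw).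
Qed.

Let density_limitE :
  ae_eq Pc setT ('d (charge_of_finite_measure Ps) '/d Pc)
    (fun w => (y w)^-1%:E).
Proof.
have PcPs := limit_dominates; have PsPc := dominates_limit.
apply: (null_dominates_ae_eq measurableT PcPs).
have PcRN : ae_eq Ps setT ('d (charge_of_finite_measure Pc) '/d Ps) f.
  apply: integral_ae_eq => //; first exact: Radon_Nikodym_integrable.
  by move=> A _ mA; rewrite -Radon_Nikodym_integral//= -PcfE.
have chain := @Radon_Nikodym_chain_rule _ _ _ (charge_of_finite_measure Ps)
  Ps Pc PsPc PcPs.
have self := Radon_Nikodym_self Ps.
apply: filterS3 (filterI fE y_gt0) PcRN (filterI chain self).
move=> w [fw yw] /(_ I) PcRNw [/(_ I) + /(_ I) selfw] _.
rewrite selfw /= PcRNw fw.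
have /fineK <- :=
  @Radon_Nikodym_fin_num _ _ _ (charge_of_finite_measure Ps) _ w PsPc.
rewrite -EFinM => -[e]; congr EFin.
by apply: (mulIf (lt0r_neq0 yw)); rewrite -e mulVf ?gt_eqF.
Qed.

(** If the densities of Pc with respect to Ps on larger and larger collections
    of events are bounded and converge to y > 0, then y is the density of Pc on
    the generated sigma-algebra; positivity makes the laws equivalent, and then
    1 / y is the reverse density by the chain rule. *)
Lemma density_limit : [/\ Ps `<< Pc, Pc `<< Ps &
  ae_eq Pc setT ('d (charge_of_finite_measure Ps) '/d Pc)
    (fun w => (y w)^-1%:E)].
Proof.
by split; [exact: dominates_limit|exact: limit_dominates|exact: density_limitE].
Qed.

End density_limit.

(** * The rate A htilde / htilde *)

Section guiding_rate.
Context (R : realType) (lambda : int -> R) (tlambda T : R) (x0 xT : int).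

(** The value 0 outside the range from x0 to xT agrees with the convention r /
    0 = 0 for A htilde / htilde, since htilde vanishes there. *)
Definition guiding_rate (s : R) (x : int) : R :=
  if x0 <= x <= xT then
    (lambda x - tlambda) * ((xT - x)%:~R / (tlambda * (T - s)) - 1)
  else 0.

Lemma derive_htilde n (s : R) :
  derive1 (fun u => (tlambda * (T - u)) ^+ n / n`!%:R *
                    expR (- (tlambda * (T - u)))) s =
  tlambda * ((tlambda * (T - s)) ^+ n / n`!%:R -
             n%:R * (tlambda * (T - s)) ^+ n.-1 / n`!%:R) *
  expR (- (tlambda * (T - s))).
Proof.
rewrite derive1E.
pose t u : R := tlambda * (T - u).
have dt : is_derive s 1 t (- tlambda).
  have -> : t = (fun u => (- tlambda) *: u + tlambda * T).
    by apply/funext => u; rewrite /t /GRing.scale/=; ring.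
  apply: is_derive_eq; rewrite /GRing.scale/=; ring.
have de : is_derive s 1 (expR \o (fun u => - t u)) (expR (- t s) * tlambda).
  by apply: is_derive1_comp; apply: is_derive_eq; rewrite opprK.
have -> : (fun u => (tlambda * (T - u)) ^+ n / n`!%:R *
                    expR (- (tlambda * (T - u)))) =
    ((t ^+ n) * cst (n`!%:R^-1)) * (expR \o (fun u => - t u)).
  by apply/funext => u; rewrite !fctE.
rewrite derive_val /GRing.scale/= !fctE -/(t s).
ring.
Qed.

(** With n = xT - x and tau = tlambda (T - s), htilde is the Poisson
    probability of n at parameter tau. Its logarithmic time derivative is
    -tlambda (n / tau - 1), and the jump x -> x + 1 multiplies it by n / tau,
    which is also the right factor 0 when x = xT. *)
Lemma space_time_htilde (s : R) (x : int) : 0 < tlambda -> 0 < s < T ->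
  space_time lambda (htilde T tlambda x0 xT) s x / htilde T tlambda x0 xT s x =
  guiding_rate s x.
Proof.
move=> l0 /andP[s0 sT].
rewrite /guiding_rate /space_time; case: ifPn => [/andP[x0x xxT]|xout]; last first.
  have -> : htilde T tlambda x0 xT s x = 0.
    by rewrite /htilde (negbTE xout) andbF.
  by rewrite invr0 mulr0.
pose n := `|(xT - x)%R|%N.
have nE : (xT - x)%:~R = n%:R :> R.
  by rewrite /n -[RHS]/(n%:Z%:~R) gez0_abs ?subr_ge0.
pose tau := tlambda * (T - s).
have tau0 : 0 < tau by rewrite mulr_gt0// subr_gt0.
have hs : htilde T tlambda x0 xT s x = tau ^+ n / n`!%:R * expR (- tau).
  by rewrite /htilde (ltW s0) sT x0x xxT.
have dh : derive1 (fun u => htilde T tlambda x0 xT u x) s =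
    tlambda * (tau ^+ n / n`!%:R - n%:R * tau ^+ n.-1 / n`!%:R) * expR (- tau).
  rewrite -derive_htilde !derive1E; apply: near_eq_derive.
  have : \forall u \near s, u \in `]0, T[.
    by apply: near_in_itvoo; rewrite in_itv/= s0 sT.
  apply: filterS => u; rewrite in_itv/= => /andP[u0 uT].
  by rewrite /htilde (ltW u0) uT x0x xxT.
rewrite dh /generator hs nE -/tau.
have e0 : expR (- tau) != 0 by rewrite gt_eqF// expR_gt0.
have [xE|xneq] := eqVneq x xT.
  have n0 : n = 0%N by rewrite /n xE subrr.
  have -> : htilde T tlambda x0 xT s (x + 1) = 0.
    have /negbTE nle : ~~ (xT + 1 <= xT) by rewrite -ltNge ltzD1.
    by rewrite /htilde xE nle !andbF.
  rewrite n0 fact0 !expr0 /=.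
  by field; rewrite e0 gt_eqF.
have x1 : x + 1 <= xT by rewrite -ltzD1 ltrD2r lt_neqAle xneq.
have [m nm] : exists m, n = m.+1.
  exists n.-1; rewrite prednK// lt0n /n absz_eq0 subr_eq0 eq_sym //.
have x1E : `|(xT - (x + 1))%R|%N = m.
  rewrite opprD addrA.
  have -> : xT - x = m.+1%:Z by rewrite -nm /n gez0_abs ?subr_ge0.
  by rewrite -addn1 PoszD addrK.
have hs1 : htilde T tlambda x0 xT s (x + 1) = tau ^+ m / m`!%:R * expR (- tau).
  by rewrite /htilde (ltW s0) sT x1 (le_trans x0x) ?lerDl// x1E.
rewrite hs1 nm factS natrM exprS /=.
have m0 : m`!%:R != 0 :> R by rewrite pnatr_eq0 -lt0n fact_gt0.
have m1 : m.+1%:R != 0 :> R by rewrite pnatr_eq0.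
have tm0 : tau ^+ m != 0 by rewrite expf_neq0// gt_eqF.
have t0 : tau != 0 by rewrite gt_eqF.
by field; rewrite nat1r m0 e0 t0 tm0 m1.
Qed.

End guiding_rate.

(** * Measurability along right-continuous paths *)

Lemma near_right_ex (R : realType) (t : R) (Q : R -> Prop) :
  (\forall s \near t^'+, Q s) -> exists2 e, 0 < e & forall s, t < s < t + e -> Q s.
Proof.
move=> /nbhs_ballP[e /= e0 eQ]; exists e => // s /andP[ts ste].
by apply: eQ => //; rewrite /ball/= ltr_distlC; apply/andP; split => //; lra.
Qed.

Lemma near_left_ex (R : realType) (t : R) (Q : R -> Prop) :
  (\forall s \near t^'-, Q s) -> exists2 e, 0 < e & forall s, t - e < s < t -> Q s.
Proof.
move=> /nbhs_ballP[e /= e0 eQ]; exists e => // s /andP[ts ste].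
by apply: eQ => //; rewrite /ball/= ltr_distlC; apply/andP; split => //; lra.
Qed.

Section right_continuous_path.
Context (R : realType) (c : R -> int).
Hypothesis right_c : forall t, 0 <= t -> \forall s \near t^'+, c s = c t.

(** The first point of the grid of mesh 1 / (n + 1) that lies strictly after s. *)
Let grid n (s : R) : R := (Num.trunc (n.+1%:R * s)).+1%:R / n.+1%:R.

Let grid_itv n s : 0 <= s -> s < grid n s <= s + n.+1%:R^-1.
Proof.
move=> s0; have n0 : 0 < n.+1%:R :> R by [].
have /truncn_itv/andP[l u] : 0 <= n.+1%:R * s by rewrite mulr_ge0.
rewrite /grid ltr_pdivlMr// [s * _]mulrC u/= ler_pdivrMr// mulrDl.
by rewrite mulVf ?gt_eqF// -natr1 lerD2r [s * _]mulrC.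
Qed.

Let measurable_grid_level n (x : int) :
  measurable ([set s : R | 0 <= s] `&` [set s | c (grid n s) = x]).
Proof.
rewrite (_ : _ `&` _ = \bigcup_k
    (if c (k.+1%:R / n.+1%:R) == x
     then `[k%:R / n.+1%:R, k.+1%:R / n.+1%:R[%classic else set0)); last first.
  have n0 : 0 < n.+1%:R :> R by [].
  apply/seteqP; split => [s [/= s0 cx]|s [k _]].
    exists (Num.trunc (n.+1%:R * s)) => //.
    rewrite -/(grid n s) cx eqxx /= in_itv /=.
    have /truncn_itv/andP[l u] : 0 <= n.+1%:R * s by rewrite mulr_ge0.
    by rewrite ler_pdivrMr// ltr_pdivlMr// [s * _]mulrC l u.
  case: ifPn => // /eqP cx; rewrite /= in_itv/=.
  rewrite ler_pdivrMr// ltr_pdivlMr// [s * _]mulrC => /andP[l u].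
  have s0 : 0 <= s.
    by rewrite -(pmulr_rge0 _ n0); apply: le_trans l.
  split => //=; rewrite /grid (@truncn_def _ _ k)// l u//.
by apply: bigcup_measurable => k _; case: ifP.
Qed.

(** The grid points after s decrease to s from the right, so c is constant
    along them eventually; the level set is thus a lower limit of level sets of
    step functions. *)
Lemma measurable_level (x : int) :
  measurable ([set s : R | 0 <= s] `&` [set s | c s = x]).
Proof.
rewrite (_ : _ `&` _ = \bigcup_N \bigcap_(n in [set n | (N <= n)%N])
    ([set s : R | 0 <= s] `&` [set s | c (grid n s) = x])).
  apply: bigcup_measurable => N _; apply: bigcap_measurable => //.
  by exists N => /=.
apply/seteqP; split => [s [/= s0 cx]|s [N _ h]].
  have [e e0 he] := near_right_ex (right_c s0).
  exists (Num.trunc e^-1) => // n /= Nn; split => //.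
  rewrite -cx; apply: he.
  have /andP[-> u] := grid_itv n s0.
  apply: (le_lt_trans u); rewrite ltrD2l invf_plt ?posrE//.
  have /truncn_itv/andP[_ h] : 0 <= e^-1 by rewrite invr_ge0 ltW.
  by apply: (lt_le_trans h); rewrite ler_nat ltnS.
have [s0 _] := h N (leqnn N).
split => //=.
have [e e0 he] := near_right_ex (right_c s0).
pose n := maxn N (Num.trunc e^-1).
have [_ <-] := h n (leq_maxl _ _).
apply/esym/he.
have /andP[-> u] := grid_itv n s0.
apply: (le_lt_trans u); rewrite ltrD2l invf_plt ?posrE//.
have /truncn_itv/andP[_ h'] : 0 <= e^-1 by rewrite invr_ge0 ltW.
by apply: (lt_le_trans h'); rewrite ler_nat ltnS leq_maxr.
Qed.

(** The state space is countable: cut D along the level sets of the path. *)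
Lemma measurable_along_path (D : set R) (g : R -> int -> R) :
  measurable D -> (forall s, D s -> 0 <= s) ->
  (forall x, measurable_fun D (g ^~ x)) ->
  measurable_fun D (fun s => g s (c s)).
Proof.
move=> mD D0 mg _ B mB.
rewrite (_ : _ `&` _ = \bigcup_x
    (([set s : R | 0 <= s] `&` [set s | c s = x]) `&` (D `&` (g ^~ x) @^-1` B))).
  apply: countable_bigcupT_measurable => // x.
  by apply: measurableI; [exact: measurable_level | exact: mg].
apply/seteqP; split => [s [Ds Bs]|s [x _ [[/= s0 <-] [Ds Bs]]]]; last by split.
by exists (c s) => //; split; split => //=; exact: D0.
Qed.

End right_continuous_path.

(** * Integrating the rate along a path *)

Section guiding_rate_along_path.
Context (R : realType) (lambda : int -> R) (tlambda T : R) (x0 xT : int).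
Hypothesis T0 : 0 < T.
Hypothesis x0_le_xT : x0 <= xT.
Hypothesis tl0 : 0 < tlambda.
Hypothesis tl_le : forall x, x0 <= x <= xT -> tlambda <= lambda x.
Local Notation G := (guiding_rate lambda tlambda T x0 xT).
Local Notation ht := (htilde T tlambda x0 xT).
Local Notation mu := (@lebesgue_measure R).

(** An upper bound for |lambda - tlambda| on the range from x0 to xT. *)
Definition guiding_gap : R :=
  \sum_(i < (`|(xT - x0)%R|%N).+1) `|lambda (x0 + i%:Z) - tlambda|.

Local Notation L := guiding_gap.

Let L_ge0 : 0 <= L.
Proof. by apply: sumr_ge0. Qed.

Let lambda_le x : x0 <= x <= xT -> `|lambda x - tlambda| <= L.
Proof.
move=> /andP[x0x xxT].
have xE : (`|(x - x0)%R|%N < (`|(xT - x0)%R|%N).+1)%N.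
  rewrite ltnS -lez_nat !gez0_abs ?subr_ge0 ?(le_trans x0x)//.
  by rewrite lerD2r.
rewrite /guiding_gap (bigD1 (Ordinal xE))//= gez0_abs ?subr_ge0//.
have -> : x0 + (x - x0) = x by rewrite addrC subrK.
by rewrite lerDl sumr_ge0.
Qed.

(** This is where tlambda <= lambda matters: the term that explodes at T is
    nonnegative. *)
Let G_ge s x : s < T -> - L <= G s x.
Proof.
move=> sT; rewrite /guiding_rate; case: ifPn => [xin|_]; last by rewrite oppr_le0.
have := lambda_le xin; rewrite ger0_norm ?subr_ge0 ?tl_le// => xL.
have q0 : 0 <= (xT - x)%:~R / (tlambda * (T - s)) :> R.
  rewrite divr_ge0// ?ler0z ?subr_ge0; first by case/andP: xin.
  by rewrite ltW// mulr_gt0// subr_gt0.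
rewrite mulrBr mulr1 -[leLHS]add0r lerB// mulr_ge0// subr_ge0.
exact: tl_le.
Qed.

Let G_bnd t s x : t < T -> s <= t ->
  `|G s x| <= L * ((xT - x0)%:~R / (tlambda * (T - t)) + 1).
Proof.
move=> tT st; have sT := le_lt_trans st tT.
have tT0 : 0 < tlambda * (T - t) by rewrite mulr_gt0// subr_gt0.
have sT0 : 0 < tlambda * (T - s) by rewrite mulr_gt0// subr_gt0.
rewrite /guiding_rate; case: ifPn => [xin|_]; last first.
  by rewrite normr0 mulr_ge0// addr_ge0// divr_ge0// ?ler0z ?subr_ge0// ltW.
rewrite normrM ler_pM//; first exact: lambda_le.
have /andP[x0x xxT] := xin.
apply: (le_trans (ler_normB _ _)); rewrite normr1 lerD2r ger0_norm; last first.
  by rewrite divr_ge0// ?ler0z ?subr_ge0// ltW.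
apply: ler_pM; rewrite ?ler0z ?subr_ge0 ?invr_ge0 ?(ltW sT0)//.
  by rewrite ler_int lerB.
by rewrite lef_pV2 ?posrE// ler_pM2l// lerB.
Qed.

Variable c : R -> int.
Hypothesis right_c : forall t, 0 <= t -> \forall s \near t^'+, c s = c t.

Let mG : measurable_fun `[0, T] (fun s => G s (c s)).
Proof.
apply: measurable_along_path => //.
  by move=> s /=; rewrite in_itv/= => /andP[].
move=> x; apply/measurable_fun_itv_bndo_bndcP.
apply: (@measurable_funS _ _ _ _ `]-oo, T[%classic) => //.
  by move=> s /=; rewrite !in_itv/= => /andP[].
apply: open_continuous_measurable_fun; first exact: interval_open.
move=> s; rewrite inE/= in_itv/= => sT.
case: (boolP (x0 <= x <= xT)) => xin; last first.
  rewrite (_ : G ^~ x = cst 0); first exact: cvg_cst.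
  by apply/funext => u; rewrite /guiding_rate (negbTE xin).
rewrite (_ : G ^~ x = fun u =>
    (lambda x - tlambda) * ((xT - x)%:~R / (tlambda * (T - u)) - 1)); last first.
  by apply/funext => u; rewrite /guiding_rate xin.
apply: cvgM; first exact: cvg_cst.
apply: cvgB; last exact: cvg_cst.
apply: cvgM; first exact: cvg_cst.
apply: cvgV; first by rewrite mulf_neq0// gt_eqF// subr_gt0.
apply: cvgM; first exact: cvg_cst.
by apply: cvgB; [exact: cvg_cst | exact: cvg_id].
Qed.

Let finite_itv (a b : R) : (mu `[a, b] < +oo)%E.
Proof.
by rewrite lebesgue_measure_itv/=; case: ifP => _; rewrite -?EFinD ltry.
Qed.

Let integrableG_before t : 0 <= t < T ->
  mu.-integrable `[0, t] (EFin \o (fun s => G s (c s))).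
Proof.
move=> /andP[t0 tT]; apply: measurable_bounded_integrable => //.
- exact: finite_itv.
- apply: measurable_funS mG => // s /=; rewrite !in_itv/= => /andP[-> st].
  by rewrite (le_trans st)// ltW.
- exists (L * ((xT - x0)%:~R / (tlambda * (T - t)) + 1)); split => //.
    by rewrite num_real.
  move=> M LM s /=; rewrite in_itv/= => /andP[s0 st].
  by apply: (le_trans _ (ltW LM)); exact: G_bnd.
Qed.

(** At time 0 the function htilde jumps, so the integrands may differ there,
    but they agree on ]0, t]. *)
Lemma integral_guiding_rate t : 0 <= t < T ->
  \int[mu]_(s in `[0, t])
     (space_time lambda ht s (c s) / ht s (c s)) =
  \int[mu]_(s in `[0, t]) G s (c s).
Proof.
move=> tin; have /andP[t0 tT] := tin.
have iG : mu.-integrable `]0, t] (EFin \o (fun s => G s (c s))).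
  apply: integrableS (integrableG_before tin) => //.
  by move=> s /=; rewrite !in_itv/= => /andP[/ltW -> ->].
have eG : {in `]0, t]%classic, (fun s => G s (c s)) =1
    (fun s => space_time lambda ht s (c s) / ht s (c s))}.
  move=> s; rewrite inE/= in_itv/= => /andP[s0 st].
  by rewrite space_time_htilde// s0 (le_lt_trans st).
rewrite -Rintegral_itv_obnd_cbnd; last first.
  by apply: eq_integrable iG => // s sin; congr EFin; exact: eG.
rewrite -[RHS]Rintegral_itv_obnd_cbnd//.
by apply: eq_Rintegral => s sin; rewrite eG.
Qed.

Lemma integral_guiding_rate_ge t : 0 <= t < T ->
  - (L * T) <= \int[mu]_(s in `[0, t]) G s (c s).
Proof.
move=> tin; have /andP[t0 tT] := tin.
apply: (@le_trans _ _ (\int[mu]_(s in `[0, t]) (- L))).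
  rewrite Rintegral_cst//= lebesgue_measure_itv/= lte_fin.
  case: ifPn => _ /=; last by rewrite mulr0 oppr_le0 mulr_ge0// ltW.
  by rewrite subr0 mulNr lerN2 ler_wpM2l// ltW.
apply: le_Rintegral => //.
- apply: (@measurable_bounded_integrable _ _ _ _ (cst (- L))) => //.
    exact: finite_itv.
  exact: bounded_cst.
- exact: integrableG_before.
- move=> s /=; rewrite in_itv/= => /andP[_ st].
  by apply: G_ge; exact: le_lt_trans tT.
Qed.

Variables (e : R).
Hypothesis e0 : 0 < e.
Hypothesis c_end : forall s, T - e < s < T -> c s = xT.

(** Once the path has reached xT the singular term vanishes, hence the rate is
    bounded up to time T. *)
Lemma integrable_guiding_rate :
  mu.-integrable `[0, T] (EFin \o (fun s => G s (c s))).
Proof.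
(* before t the distance to T bounds the rate; after t the path sits at xT *)
pose t := Num.max (T - e / 2) 0.
have tT : t < T by rewrite gt_max T0 andbT gtrBl divr_gt0.
have B0 : 0 <= (xT - x0)%:~R / (tlambda * (T - t)) :> R.
  by rewrite divr_ge0// ?ler0z ?subr_ge0// mulr_ge0// ?subr_ge0 ltW.
apply: measurable_bounded_integrable => //.
- exact: finite_itv.
- exists (L * ((xT - x0)%:~R / (tlambda * (T - t)) + 1)); split => //.
    by rewrite num_real.
  move=> M LM s /=; rewrite in_itv/= => /andP[s0 sT].
  apply: (le_trans _ (ltW LM)).
  have [st|ts] := leP s t; first exact: G_bnd.
  rewrite /guiding_rate; case: ifPn => [xin|_]; last first.
    by rewrite normr0 mulr_ge0// addr_ge0.
  have -> : (xT - c s)%:~R / (tlambda * (T - s)) = 0 :> R.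
    move: sT; rewrite le_eqVlt => /predU1P[->|sT].
      by rewrite subrr mulr0 invr0 mulr0.
    rewrite c_end ?subrr ?mul0r// sT andbT.
    apply: le_lt_trans ts; rewrite le_max lerB// ger_pMr// invf_le1//.
    by rewrite ler1n.
  rewrite sub0r normrM normrN1 ler_pM// ?lambda_le//.
  by rewrite lerDr.
Qed.

Lemma integral_guiding_rate_cvg :
  \int[mu]_(s in `[0, t]) G s (c s) @[t --> T^'-] -->
  \int[mu]_(s in `[0, T]) G s (c s).
Proof.
exact: (parameterized_integral_cvg_at_left T0 integrable_guiding_rate).
Qed.

End guiding_rate_along_path.

(** * Short-time bounds on the transition probabilities *)

Section past_events.
Context d (Omega : measurableType d) (R : realType).
Variable X : R -> {mfun Omega >-> int}.

Lemma past_state (s t : R) (B : set int) : 0 <= s <= t ->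
  <<s past X t >> (X s @^-1` B).
Proof.
move=> st; apply: sub_sigma_algebra; exists s; first by rewrite /= in_itv.
by exists B => //; rewrite setTI.
Qed.

Lemma past_le (s t : R) : s <= t -> <<s past X s >> `<=` <<s past X t >>.
Proof.
move=> st; apply: sub_sigma_algebra2 => _ [r /= + [B mB <-]].
rewrite in_itv/= => /andP[r0 rs]; exists r; last by exists B.
by rewrite /= in_itv/= r0 (le_trans rs).
Qed.

Lemma past_setI (t : R) A B :
  <<s past X t >> A -> <<s past X t >> B -> <<s past X t >> (A `&` B).
Proof. exact: (@measurableI _ (g_sigma_algebraType (past X t))). Qed.

End past_events.

Section transition_bounds.
Context d (Omega : measurableType d) (R : realType).
Variables (X : R -> {mfun Omega >-> int}) (P : probability Omega R).
Variables (lambda : int -> R) (p : R -> int -> int -> R).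
Hypothesis markov : forall s u A x y, 0 <= s -> 0 <= u -> <<s past X s >> A ->
  P (A `&` X s @^-1` [set x] `&` X (s + u) @^-1` [set y]) =
  (P (A `&` X s @^-1` [set x]) * (p u x y)%:E)%E.
Hypothesis p_rate : forall x y,
  (p u x y - (x == y)%:R) / u @[u --> 0^'+] -->
    generator lambda (fun z => (z == y)%:R) x.

Local Notation Pr A := (fine (P A)).

Lemma fine_probabilityE A : measurable A -> P A = (Pr A)%:E.
Proof. by move=> mA; rewrite fineK// fin_num_measure. Qed.

Lemma fine_probability_le A B : measurable A -> measurable B -> A `<=` B ->
  Pr A <= Pr B.
Proof.
move=> mA mB AB; apply: fine_le; rewrite ?fin_num_measure//.
by apply: le_measure; rewrite ?inE.
Qed.

Lemma fine_probability_ge0 A : 0 <= Pr A.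
Proof. exact: fine_ge0. Qed.

Lemma transition_cvg x y : p u x y @[u --> 0^'+] --> ((x == y)%:R : R).
Proof.
have u0 : u @[u --> (0:R)^'+] --> (0 : R) by exact: cvg_at_right_filter.
have : (p u x y - (x == y)%:R) / u * u + (x == y)%:R @[u --> 0^'+] -->
    generator lambda (fun z => (z == y)%:R) x * 0 + (x == y)%:R.
  by apply: cvgD; [exact: cvgM | exact: cvg_cst].
rewrite mulr0 add0r; apply: cvg_trans; apply: near_eq_cvg.
near=> u.
have u_gt0 : 0 < u by near: u; exact: nbhs_right_gt.
by rewrite divfK ?lt0r_neq0// subrK.
Unshelve. all: by end_near. Qed.

Lemma transition_succ x : 0 < lambda x ->
  \forall u \near 0^'+, lambda x / 2 * u <= p u x (x + 1).
Proof.
move=> lx.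
have := @p_rate x (x + 1).
rewrite /generator eqxx.
have -> : (x == x + 1) = false by rewrite -{1}[x]addr0 (inj_eq (addrI x)).
rewrite subr0 mulr1 => /cvgr_ge h.
have /h : lambda x / 2 < lambda x by rewrite ltr_pdivrMr// ltr_pMr// ltr1n.
move=> h'; near=> u.
have u_gt0 : 0 < u by near: u; exact: nbhs_right_gt.
have : lambda x / 2 <= (p u x (x + 1) - 0) / u by near: u.
by rewrite subr0 ler_pdivlMr.
Unshelve. all: by end_near. Qed.

Let mA s A : <<s past X s >> A -> measurable A.
Proof. exact: past_measurable. Qed.

Let mX := measurable_state X.

Let markovR s u A x y : 0 <= s -> 0 <= u -> <<s past X s >> A ->
  Pr (A `&` X s @^-1` [set x] `&` X (s + u) @^-1` [set y]) =
  Pr (A `&` X s @^-1` [set x]) * p u x y.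
Proof.
move=> s0 u0 pA; rewrite markov// fineM//.
by rewrite fin_num_measure//; apply: measurableI => //; exact: mA pA.
Qed.

(** Reaching y from y - m requires m jumps. The time u is halved at each jump:
    one jump occurs in the first half, with probability at least lambda u / 4,
    and the others in the second half. Joint probabilities with a past event A
    are bounded, instead of p itself, because p is determined only at states
    that are visited with positive probability. *)
Lemma transition_lower_bound (y : int) N :
  (forall m, (m < N)%N -> 0 < lambda (y - m.+1%:Z)) ->
  exists c e, [/\ 0 < c, 0 < e & forall m u s A, (m <= N)%N -> 0 < u < e ->
    0 <= s -> <<s past X s >> A ->
    Pr (A `&` X s @^-1` [set y - m%:Z]) * (c * u ^+ m) <=
    Pr (A `&` X s @^-1` [set y - m%:Z] `&` X (s + u) @^-1` [set y])].
Proof.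
elim: N => [_|N IH lpos].
  have : \forall u \near 0^'+, 1 / 2 <= p u y y.
    have := @transition_cvg y y; rewrite eqxx => /cvgr_ge; apply.
    by rewrite ltr_pdivrMr// mul1r ltr1n.
  move=> /near_right_ex[e e0 he]; exists (1 / 2), e; split => //.
  move=> m u s A; rewrite leqn0 => /eqP -> /andP[u0 ue] s0 pA.
  rewrite subr0 expr0 mulr1 markovR//; last exact: ltW.
  by apply: ler_wpM2l; rewrite ?fine_probability_ge0// he// u0 add0r.
have [c [e [c0 e0 h]]] := IH (fun m mN => lpos m (ltnW mN)).
set x := y - N.+1%:Z.
have lx : 0 < lambda x := lpos N (ltnSn N).
have [e1 e10 h1] := near_right_ex (transition_succ lx).
(* first jump: lambda x / 2 * (u / 2); the other N jumps: c * (u / 2) ^ N *)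
pose c' := lambda x / 2 * c * (1 / 2) ^+ N.+1.
have c'0 : 0 < c' by rewrite !mulr_gt0.
exists (Num.min c c'), (Num.min e e1); split; rewrite ?lt_min ?c0 ?e0//.
move=> m u s A; rewrite leq_eqVlt ltnS => /predU1P[->|mN] /andP[u0].
  rewrite lt_min => /andP[ue ue1] s0 pA; rewrite -/x.
  pose v := u / 2.
  have v0 : 0 < v by rewrite divr_gt0.
  have vu : v < u by rewrite ltr_pdivrMr// ltr_pMr// ltr1n.
  have pA' : <<s past X (s + v) >> (A `&` X s @^-1` [set x]).
    apply: past_setI; first by apply: past_le pA; rewrite lerDl ltW.
    by apply: past_state; rewrite s0 lerDl ltW.
  have xN : y - N%:Z = x + 1 by rewrite /x -addn1 PoszD; ring.
  have sv0 : 0 <= s + v by rewrite addr_ge0// ltW.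
  have ve : 0 < v < e by rewrite v0 (lt_trans vu).
  have := h N v (s + v) _ (leqnn N) ve sv0 pA'.
  rewrite xN markovR// ?(ltW v0)//.
  have -> : s + v + v = s + u by rewrite -addrA /v -splitr.
  move=> hv.
  have mAx : measurable (A `&` X s @^-1` [set x]).
    by apply: measurableI => //; exact: mA pA.
  apply: (le_trans _ (le_trans hv _)); last first.
    apply: fine_probability_le; try by do 2?apply: measurableI => //.
    by move=> w [[? ?] ?].
  rewrite -mulrA; apply: ler_wpM2l; first exact: fine_probability_ge0.
  have pv : lambda x / 2 * v <= p v x (x + 1).
    by apply: h1; rewrite v0 add0r (lt_trans vu).
  apply: (@le_trans _ _ (lambda x / 2 * v * (c * v ^+ N))); last first.
    by apply: ler_wpM2r => //; rewrite mulr_ge0 ?exprn_ge0// ltW.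
  apply: (@le_trans _ _ (c' * u ^+ N.+1)).
    by apply: ler_wpM2r; rewrite ?exprn_ge0 ?(ltW u0)// ge_min lexx orbT.
  rewrite le_eqVlt; apply/orP; left; apply/eqP.
  rewrite /c' /v !exprS !exprMn expr1n; ring.
rewrite lt_min => /andP[ue ue1] s0 pA.
have := h m u s A mN _ s0 pA; rewrite u0 ue => /(_ isT); apply: le_trans.
apply: ler_wpM2l; first exact: fine_probability_ge0.
by apply: ler_wpM2r; rewrite ?exprn_ge0 ?(ltW u0)// ge_min lexx.
Qed.

End transition_bounds.

(** * The conditioned law *)

Section conditioning.
Context d (Omega : measurableType d) (R : realType).
Variables (X : R -> {mfun Omega >-> int}) (P : probability Omega R).
Variables (lambda : int -> R) (x0 xT : int) (T : R).
Hypothesis T0 : 0 < T.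
Hypothesis x0xT : x0 <= xT.
Hypothesis lambda_gt0 : forall x, x0 <= x <= xT -> 0 < lambda x.
Hypothesis jumpX : jump_process X P lambda x0.

Local Notation Pr A := (fine (P A)).
Local Notation h := (hitting X P T xT).
Local Notation Pstar := (conditioned X P T xT).

Let mX := measurable_state X.

Let mA s A : <<s past X s >> A -> measurable A.
Proof. exact: past_measurable. Qed.

(** Divide [0, t] into steps so short that staying at x0 during one of them has
    probability at least some c > 0. *)
Lemma start_gt0 t : 0 <= t -> 0 < Pr (X t @^-1` [set x0]).
Proof.
move=> t0; have [start _ _ [p [markov p_rate]]] := jumpX.
have [//|c [e [c0 e0 bnd]]] := @transition_lower_bound _ _ _ X P _ _ markov p_rate x0 0.
pose k := (Num.trunc (t / e)).+1.
have k0 : 0 < k%:R :> R by rewrite ltr0n.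
pose u := t / k%:R.
have u0 : 0 <= u by rewrite divr_ge0.
have ue : u < e.
  rewrite /u ltr_pdivrMr// mulrC -ltr_pdivrMr//.
  by have /truncn_itv/andP[] : 0 <= t / e by rewrite divr_ge0// ltW.
have step i : 0 < Pr (X (i%:R * u) @^-1` [set x0]).
  elim: i => [|i IH]; first by rewrite mul0r start.
  move: u0; rewrite le_eqVlt => /predU1P[u0|u0].
    by move: IH; rewrite -u0 !mulr0.
  have iu0 : 0 <= i%:R * u by rewrite mulr_ge0// ltW.
  have sT : <<s past X (i%:R * u) >> setT.
    exact: (@measurableT _ (g_sigma_algebraType (past X (i%:R * u)))).
  have uin : 0 < u < e by rewrite u0.
  have := bnd 0%N u (i%:R * u) setT (leqnn 0) uin iu0 sT.
  rewrite subr0 expr0 mulr1 setTI -[i.+1%:R]natr1 mulrDl mul1r => hb.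
  apply: (lt_le_trans (mulr_gt0 IH c0)); apply: (le_trans hb).
  by apply: fine_probability_le; [exact: measurableI | exact: mX | exact: subIsetr].
have := step k; rewrite /u mulrC divfK//; first by rewrite gt_eqF.
Qed.

Let rate_pos y m : x0 <= y <= xT -> (m < `|(y - x0)%R|)%N ->
  0 < lambda (y - m.+1%:Z).
Proof.
move=> /andP[x0y yxT] mn; apply: lambda_gt0; apply/andP; split.
  rewrite lerBrDr addrC -lerBrDr -[leRHS]gez0_abs ?subr_ge0//.
by apply: le_trans yxT; rewrite lerBlDr lerDl.
Qed.

(** Stay at x0 until shortly before t, then jump up to y. *)
Lemma state_gt0 t y : 0 < t -> x0 <= y <= xT -> 0 < Pr (X t @^-1` [set y]).
Proof.
move=> t0 yin; have [start _ _ [p [markov p_rate]]] := jumpX.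
pose n := `|(y - x0)%R|%N.
have yn : y - n%:Z = x0.
  by rewrite /n gez0_abs ?subr_ge0; [rewrite opprB addrC subrK | case/andP: yin].
have [m|c [e [c0 e0 bnd]]] :=
    @transition_lower_bound _ _ _ X P _ _ markov p_rate y n.
  exact: rate_pos.
pose u := Num.min (e / 2) t.
have u0 : 0 < u by rewrite lt_min t0 divr_gt0.
have uin : 0 < u < e.
  by rewrite u0 gt_min ltr_pdivrMr// ltr_pMr// ltr1n.
have s0 : 0 <= t - u by rewrite subr_ge0 ge_min lexx orbT.
have sT : <<s past X (t - u) >> setT.
  exact: (@measurableT _ (g_sigma_algebraType (past X (t - u)))).
have := bnd n u (t - u) setT (leqnn n) uin s0 sT.
rewrite yn subrK setTI => hb.
apply: (@lt_le_trans _ _ (Pr (X (t - u) @^-1` [set x0]) * (c * u ^+ n))).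
  by rewrite !mulr_gt0 ?exprn_gt0 ?start_gt0.
apply: (le_trans hb).
by apply: fine_probability_le; [exact: measurableI | exact: mX | exact: subIsetr].
Qed.

Lemma hitting_ge0 t x : 0 <= h t x.
Proof. by rewrite /hitting divr_ge0// fine_ge0. Qed.

Lemma hitting_transition : exists2 p : R -> int -> int -> R,
  (forall x y, p u x y @[u --> 0^'+] --> ((x == y)%:R : R)) &
  forall t x, 0 <= t <= T -> 0 < Pr (X t @^-1` [set x]) ->
    h t x = p (T - t) x xT.
Proof.
have [_ _ _ [p [markov p_rate]]] := jumpX.
exists p => [x y|t x /andP[t0 tT] pos]; first exact: (transition_cvg p_rate).
have sT : <<s past X t >> setT.
  exact: (@measurableT _ (g_sigma_algebraType (past X t))).
have u0 : 0 <= T - t by rewrite subr_ge0.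
have := markov t (T - t) setT x xT t0 u0 sT.
rewrite setTI addrC subrK setIC => hE.
rewrite /hitting hE fineM ?fin_num_measure//= [X in X / _]mulrC mulfK//.
by rewrite gt_eqF.
Qed.

(** Unlike the transition function, h is specified at every state, with value 0
    at states of probability 0, where both sides vanish. *)
Lemma hitting_markov t A x : 0 <= t <= T -> <<s past X t >> A ->
  P (A `&` X t @^-1` [set x] `&` X T @^-1` [set xT]) =
  (P (A `&` X t @^-1` [set x]) * (h t x)%:E)%E.
Proof.
move=> /andP[t0 tT] pA; have [_ _ _ [p [markov p_rate]]] := jumpX.
have u0 : 0 <= T - t by rewrite subr_ge0.
have sT : <<s past X t >> setT.
  exact: (@measurableT _ (g_sigma_algebraType (past X t))).
have := markov t (T - t) A x xT t0 u0 pA.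
rewrite addrC subrK => ->.
have mAx : measurable (A `&` X t @^-1` [set x]).
  by apply: measurableI => //; exact: mA pA.
have := fine_probability_ge0 P (X t @^-1` [set x]).
rewrite le_eqVlt => /predU1P[null|pos].
  have -> : P (A `&` X t @^-1` [set x]) = 0%E.
    apply/eqP; rewrite -measure_le0.
    apply: (@le_trans _ _ (P (X t @^-1` [set x]))).
      by apply: le_measure; rewrite ?inE//; exact: subIsetr.
    by rewrite fine_probabilityE// -null.
  by rewrite !mul0e.
have := markov t (T - t) setT x xT t0 u0 sT.
rewrite setTI addrC subrK setIC => hE.
rewrite /hitting hE fineM ?fin_num_measure//= [X in X / _]mulrC mulfK//.
by rewrite gt_eqF.
Qed.

Lemma target_gt0 : 0 < Pr (X T @^-1` [set xT]).
Proof. by apply: state_gt0 => //; rewrite x0xT lexx. Qed.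

Lemma conditionedE A : measurable A ->
  Pstar A = (P (A `&` X T @^-1` [set xT]) *
             (Pr (X T @^-1` [set xT]))^-1%:E)%E.
Proof.
move=> mAA; rewrite /conditioned /= /mnormalize /= /mrestr setTI.
have := target_gt0; rewrite lt_def => /andP[ne0 _].
case: ifPn => // /orP[/eqP P0|/eqP Poo].
  by rewrite P0 eqxx in ne0.
by rewrite Poo eqxx in ne0.
Qed.

Lemma measurable_state_fun (k : int -> R) t : 0 <= t ->
  measurable_fun setT (fun w : g_sigma_algebraType (past X t) => k (X t w)).
Proof.
move=> t0 _ B mB; rewrite setTI.
rewrite -[_ @^-1` _]/(X t @^-1` (k @^-1` B)).
by apply: past_state; rewrite t0 lexx.
Qed.

(** Split A according to the countably many values of X_t and apply the Markov
    property on each piece. *)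
Lemma conditioned_density t A : 0 <= t <= T -> <<s past X t >> A ->
  Pstar A = (\int[on_past X P t]_(w in A)
     (h t (X t w) / Pr (X T @^-1` [set xT]))%:E)%E.
Proof.
move=> tin pA; have /andP[t0 tT] := tin.
have mAA := mA pA.
rewrite conditionedE//.
set q := Pr (X T @^-1` [set xT]).
have q0 : 0 < q := target_gt0.
(* the values of X_t are indexed by their codes in nat *)
pose F n := A `&` [set w | pickle (X t w) = n].
have AF : A = \bigcup_n F n.
  by apply/seteqP; split => [w Aw|w [n _ []//]]; exists (pickle (X t w)).
have tF : trivIset setT F.
  by move=> i j _ _ [w [[_ <-] [_ <-]]].
have FE n : F n = set0 \/ exists x, F n = A `&` X t @^-1` [set x].
  have [->|/set0P[w [Aw wn]]] := eqVneq (F n) set0; [by left | right].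
  exists (X t w); apply/seteqP; split => v [Av vn]; split => //=.
    by apply: (pcan_inj pickleK); rewrite vn.
  by rewrite vn.
have pF n : <<s past X t >> (F n).
  have [->|[x ->]] := FE n.
    exact: (@measurable0 _ (g_sigma_algebraType (past X t))).
  by apply: past_setI => //; apply: past_state; rewrite t0 lexx.
have mF n : measurable (F n) := mA (pF n).
have mk : measurable_fun setT (fun w : g_sigma_algebraType (past X t) =>
    (h t (X t w) / q)%:E).
  apply/measurable_EFinP.
  exact: (@measurable_state_fun (fun x => h t x / q)).
rewrite AF (@ge0_integral_bigcup _ (g_sigma_algebraType (past X t)))//; last 2 first.
- exact: measurable_funTS.
- by move=> w _; rewrite lee_fin divr_ge0 ?hitting_ge0// ltW.
rewrite setI_bigcupl measure_bigcup//; last 2 first.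
- by move=> n _; exact: measurableI.
- by apply: trivIset_setIr.
rewrite muleC -nneseriesZl//.
under eq_eseriesl do rewrite in_setT.
apply: eq_eseriesr => n _.
have [->|[x FnE]] := FE n.
  by rewrite set0I measure0 mule0 integral_set0.
rewrite (@eq_integral _ _ _ _ _ (cst (h t x / q)%:E)); last first.
  by move=> w; rewrite inE FnE => -[_ /= ->].
rewrite integral_cst//=; last exact: pF.
have -> : on_past X P t (F n) = P (F n) by [].
rewrite FnE hitting_markov// fine_probabilityE; last by rewrite -FnE.
by rewrite -!EFinM; congr EFin; ring.
Qed.

End conditioning.

(** * Comparing the pasts of different times *)

(** The law on the past of t lives on a copy of the sample space; almost sure
    statements about it are also made for points of the sample space itself. *)
#[local] Instance ae_past_filter d (Omega : measurableType d) (R : realType)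
    (X : R -> {mfun Omega >-> int}) (Q : probability Omega R) (t : R) :
  @Filter Omega (nbhs (almost_everywhere (on_past X Q t))).
Proof.
exact: (@ae_filter_ringOfSetsType _ (g_sigma_algebraType (past X t))).
Qed.

Section on_past_transfer.
Context d (Omega : measurableType d) (R : realType).
Variables (X : R -> {mfun Omega >-> int}) (Q : probability Omega R).
Variables (s t : R).
Hypothesis st : s <= t.

Lemma ae_on_past_le (A : Omega -> Prop) :
  {ae on_past X Q s, forall w, A w} -> {ae on_past X Q t, forall w, A w}.
Proof.
by move=> [N [mN N0 AN]]; exists N; split => //; exact: past_le mN.
Qed.

Lemma ae_on_past (A : Omega -> Prop) :
  {ae on_past X Q t, forall w, A w} -> {ae Q, forall w, A w}.
Proof.
by move=> [N [mN N0 AN]]; exists N; split => //; exact: past_measurable mN.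
Qed.

Lemma measurable_on_past_le (f : Omega -> \bar R) :
  measurable_fun (setT : set (g_sigma_algebraType (past X s))) f ->
  measurable_fun (setT : set (g_sigma_algebraType (past X t))) f.
Proof. by move=> mf _ B mB; apply: (past_le st); exact: mf. Qed.

Let ge0_integral_on_past_le (f : Omega -> \bar R) A :
  measurable_fun (setT : set (g_sigma_algebraType (past X s))) f ->
  (forall w, (0 <= f w)%E) -> <<s past X s >> A ->
  (\int[on_past X Q s]_(w in A) f w = \int[on_past X Q t]_(w in A) f w)%E.
Proof.
move=> mf f0 pA.
pose phi : g_sigma_algebraType (past X t) -> g_sigma_algebraType (past X s) := id.
have mphi : measurable_fun setT phi.
  by move=> _ B mB; rewrite setTI; exact: past_le mB.
have := @ge0_integral_pushforward _ _ _ _ R phi mphi (on_past X Q t) A f pA.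
move=> <- //; exact: measurable_funTS.
Qed.

(** The law on the past of s is the image of the law on the past of t under the
    identity, which is measurable from the larger to the smaller sigma-algebra. *)
Lemma integral_on_past_le (f : Omega -> \bar R) A :
  measurable_fun (setT : set (g_sigma_algebraType (past X s))) f ->
  <<s past X s >> A ->
  (\int[on_past X Q s]_(w in A) f w = \int[on_past X Q t]_(w in A) f w)%E.
Proof.
move=> mf pA; rewrite integralE [RHS]integralE; congr (_ - _)%E.
  by apply: ge0_integral_on_past_le => //; exact: measurable_funepos.
by apply: ge0_integral_on_past_le => //; exact: measurable_funeneg.
Qed.

End on_past_transfer.

(** * Behaviour near the terminal time *)

Section approach_times.
Context (R : realType) (T e : R).
Hypothesis T0 : 0 < T.
Hypothesis e0 : 0 < e.

(** Times in ]0, T[ within e of T that tend to T; k.+2 keeps approach 0 away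
    from the endpoint T - Num.min T e. *)
Definition approach (k : nat) : R := T - Num.min T e / k.+2%:R.

Let m0 : 0 < Num.min T e. Proof. by rewrite lt_min T0. Qed.

Lemma approach_lt k : 0 < approach k < T.
Proof.
rewrite /approach subr_gt0 gtrBl divr_gt0// andbT ltr_pdivrMr//.
apply: (@le_lt_trans _ _ T); first by rewrite ge_min lexx.
by rewrite ltr_pMr// ltr1n.
Qed.

Lemma approach_gt k : T - e < approach k.
Proof.
rewrite /approach ltrD2l ltrN2 ltr_pdivrMr//.
apply: (@le_lt_trans _ _ e); first by rewrite ge_min lexx orbT.
by rewrite ltr_pMr// ltr1n.
Qed.

Lemma approach_cvg : approach @ \oo --> T^'-.
Proof.
move=> A /near_left_ex[r r0 rA].
exists (Num.trunc (Num.min T e / r)) => // k /= rk; apply: rA.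
have /andP[_ ->] := approach_lt k; rewrite andbT.
rewrite /approach ltrD2l ltrN2 ltr_pdivrMr// mulrC -ltr_pdivrMr//.
have /truncn_itv/andP[_ h] : 0 <= Num.min T e / r.
  by rewrite divr_ge0// ltW.
by apply: (lt_le_trans h); rewrite ler_nat !ltnS (leq_trans rk).
Qed.

End approach_times.

Section conditioning_near_target.
Context d (Omega : measurableType d) (R : realType).
Variables (X : R -> {mfun Omega >-> int}) (P : probability Omega R).
Variables (lambda : int -> R) (tlambda : R) (x0 xT : int) (T : R).
Hypothesis T0 : 0 < T.
Hypothesis x0xT : x0 <= xT.
Hypothesis lambda_gt0 : forall x, x0 <= x <= xT -> 0 < lambda x.
Hypothesis tlambda0 : 0 < tlambda.
Hypothesis jumpX : jump_process X P lambda x0.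

Local Notation Pr A := (fine (P A)).
Local Notation h := (hitting X P T xT).
Local Notation ht := (htilde T tlambda x0 xT).
Local Notation Pstar := (conditioned X P T xT).

(** Both sides have order (T - t) ^ (xT - x) as t -> T. *)
Lemma htilde_le_hitting : exists C e, [/\ 0 < C, 0 < e &
  forall t x, 0 < t -> T - e < t < T -> x0 <= x <= xT ->
    0 < h t x /\ ht t x <= C * h t x].
Proof.
have [start _ _ [p [markov p_rate]]] := jumpX.
pose N := `|(xT - x0)%R|%N.
have NE : N%:Z = xT - x0 by rewrite /N gez0_abs ?subr_ge0.
have [m mN|c [e [c0 e0 bnd]]] :=
    @transition_lower_bound _ _ _ X P _ _ markov p_rate xT N.
  apply: lambda_gt0; apply/andP; split; last by rewrite lerBlDr lerDl.
  by rewrite lerBrDr addrC -lerBrDr -NE.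
exists ((1 + tlambda) ^+ N / c), e; split=> //.
  by rewrite divr_gt0// exprn_gt0// addr_gt0.
move=> t x t0 /andP[et tT] xin; have /andP[x0x xxT] := xin.
pose n := `|(xT - x)%R|%N.
have nE : n%:Z = xT - x by rewrite /n gez0_abs ?subr_ge0.
have nN : (n <= N)%N by rewrite -lez_nat nE NE lerB.
have xE : xT - n%:Z = x by rewrite nE opprB addrC subrK.
pose u := T - t.
have u0 : 0 < u by rewrite subr_gt0.
have uin : 0 < u < e by rewrite u0 ltrBlDr addrC -ltrBlDr.
have sT : <<s past X t >> setT.
  exact: (@measurableT _ (g_sigma_algebraType (past X t))).
have pos : 0 < Pr (X t @^-1` [set x]) by exact: (state_gt0 lambda_gt0 jumpX).
have hb : c * u ^+ n <= h t x.
  have := bnd n u t setT nN uin (ltW t0) sT.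
  rewrite xE setTI addrC subrK setIC /hitting => hb.
  by rewrite ler_pdivlMr// mulrC.
have cu0 : 0 < c * u ^+ n by rewrite mulr_gt0// exprn_gt0.
split; first exact: lt_le_trans hb.
apply: (@le_trans _ _ ((1 + tlambda) ^+ N / c * (c * u ^+ n))); last first.
  by rewrite ler_wpM2l// divr_ge0 ?exprn_ge0 ?addr_ge0 ?(ltW tlambda0) ?(ltW c0).
rewrite mulrA divfK ?gt_eqF// /htilde (ltW t0) tT xin -/n -/u /=.
apply: (@le_trans _ _ ((tlambda * u) ^+ n)).
  rewrite -mulrA ler_piMr//; first by rewrite exprn_ge0// mulr_ge0// ltW.
  rewrite mulr_ile1 ?expR_ge0 ?invr_ge0//.
    by rewrite invf_le1 ?ltr0n ?fact_gt0// ler1n fact_gt0.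
  by rewrite -expR0 ler_expR oppr_le0 mulr_ge0// ltW.
rewrite exprMn ler_pM2r ?exprn_gt0//.
apply: (@le_trans _ _ ((1 + tlambda) ^+ n)).
  by rewrite lerXn2r ?nnegrE ?addr_ge0 ?(ltW tlambda0)// lerDr.
by rewrite ler_weXn2l// lerDl ltW.
Qed.

Let remaining_cvg : T - t @[t --> T^'-] --> (0 : R)^'+.
Proof.
move=> A /near_right_ex[r r0 rA].
suff : \forall t \near T^'-, A (T - t) by [].
near=> t; apply: rA; apply/andP; split.
  by rewrite subr_gt0; near: t; exact: nbhs_left_lt.
by rewrite add0r; near: t; exact: nbhs_left_ltBl.
Unshelve. all: by end_near. Qed.

Let near_T : \forall t \near T^'-, 0 < t < T.
Proof.
near=> t; apply/andP; split; near: t; first exact: nbhs_left_gt.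
exact: nbhs_left_lt.
Unshelve. all: by end_near. Qed.

Lemma hitting_cvg : h t xT @[t --> T^'-] --> (1 : R).
Proof.
have [p p_cvg hp] := hitting_transition xT T jumpX.
have : p (T - t) xT xT @[t --> T^'-] --> (1 : R).
  have := p_cvg xT xT; rewrite eqxx => pc.
  exact: (cvg_comp _ (fun u => p u xT xT) remaining_cvg pc).
apply: cvg_trans; apply: near_eq_cvg; apply: filterS near_T => t /andP[t0 tT].
rewrite hp// ?(ltW t0) ?(ltW tT)//.
by apply: (state_gt0 lambda_gt0 jumpX) => //; rewrite x0xT lexx.
Qed.

(** The joint probability of X_t = x and X_T = xT is at most p (T - t) x xT,
    which tends to 0. *)
Lemma conditioned_state_small x eps : x != xT -> 0 < eps ->
  \forall t \near T^'-, (Pstar (X t @^-1` [set x]) <= eps%:E)%E.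
Proof.
move=> xxT eps0; have [p p_cvg hp] := hitting_transition xT T jumpX.
have q0 := target_gt0 T0 x0xT lambda_gt0 jumpX.
set q := Pr (X T @^-1` [set xT]) in q0.
have pc : p (T - t) x xT @[t --> T^'-] --> (0 : R).
  have := p_cvg x xT; rewrite (negbTE xxT) => pc.
  exact: (cvg_comp _ (fun u => p u x xT) remaining_cvg pc).
have eq0 : 0 < eps * q by rewrite mulr_gt0.
have small : \forall t \near T^'-, p (T - t) x xT <= eps * q.
  exact: (cvgr_le _ pc).
apply: filterS2 small near_T => t pt /andP[t0 tT].
have mXt := measurable_state X t x.
rewrite (conditionedE T0 x0xT lambda_gt0 jumpX)//.
have tin : 0 <= t <= T by rewrite !ltW.
have sT : <<s past X t >> setT.
  exact: (@measurableT _ (g_sigma_algebraType (past X t))).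
have := hitting_markov xT jumpX x tin sT; rewrite setTI => ->.
rewrite -/q fine_probabilityE// -!EFinM lee_fin ler_pdivrMr//.
have := fine_probability_ge0 P (X t @^-1` [set x]).
rewrite le_eqVlt => /predU1P[<-|pos]; first by rewrite mul0r ltW.
rewrite hp//; apply: (@le_trans _ _ (Pr (X t @^-1` [set x]) * (eps * q))).
  by rewrite ler_wpM2l// ltW.
rewrite ler_piMl ?(ltW eq0)//.
by rewrite -lee_fin -fine_probabilityE// probability_le1.
Qed.

End conditioning_near_target.

(** * The guided law and the conditioned law *)

Section guided_versus_conditioned.
Context d (Omega : measurableType d) (R : realType).
Variables (P Pcirc : probability Omega R) (X : R -> {mfun Omega >-> int}).
Variables (lambda : int -> R) (tlambda T : R) (x0 xT : int).
Hypothesis T0 : 0 < T.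
Hypothesis x0xT : x0 <= xT.
Hypothesis tlambda0 : 0 < tlambda.
Hypothesis jumpX : jump_process X P lambda x0.
Hypothesis guidedX : guided X P lambda (htilde T tlambda x0 xT) x0 T Pcirc.
Hypothesis tlambda_le : forall x, x0 <= x <= xT -> tlambda <= lambda x.

Local Notation h := (hitting X P T xT).
Local Notation ht := (htilde T tlambda x0 xT).
Local Notation Pstar := (conditioned X P T xT).
Local Notation G := (guiding_rate lambda tlambda T x0 xT).
Local Notation mu := (@lebesgue_measure R).
Local Notation D := (guiding_density X lambda ht x0).
Let q : R := fine (P (X T @^-1` [set xT])).

Let lambda_gt0 x : x0 <= x <= xT -> 0 < lambda x.
Proof. by move=> xin; exact: lt_le_trans (tlambda_le xin). Qed.

Let q0 : 0 < q.
Proof. exact: target_gt0 T0 x0xT lambda_gt0 jumpX. Qed.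

Let right_c w t : 0 <= t -> \forall s \near t^'+, X s w = X t w.
Proof. by move=> t0; exact: (jump_right jumpX). Qed.

Let ht_start_gt0 : 0 < ht 0 x0.
Proof.
rewrite /htilde lexx T0 lexx x0xT /= subr0.
by rewrite mulr_gt0 ?expR_gt0// divr_gt0 ?exprn_gt0 ?mulr_gt0// ltr0n fact_gt0.
Qed.

Let ht_ge0 t x : 0 <= ht t x.
Proof.
rewrite /htilde; case: ifPn => // /andP[/andP[_ tT] _].
rewrite mulr_ge0 ?expR_ge0// divr_ge0// exprn_ge0// mulr_ge0 ?(ltW tlambda0)//.
by rewrite subr_ge0 ltW.
Qed.

Let DE t w : 0 <= t < T ->
  D t w = ht t (X t w) / ht 0 x0 * expR (- \int[mu]_(s in `[0, t]) G s (X s w)).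
Proof.
move=> tin; rewrite /guiding_density.
by rewrite (integral_guiding_rate lambda x0xT tlambda0 (right_c w)).
Qed.

(** Close to T the path is at xT, where htilde and h both tend to 1, and only
    the exponential factor contributes to the limit. *)
Lemma density_cvg w e : 0 < e -> (forall s, T - e < s < T -> X s w = xT) ->
  D t w / (h t (X t w) / q) @[t --> T^'-] -->
  q / ht 0 x0 * expR (- \int[mu]_(s in `[0, T]) G s (X s w)).
Proof.
move=> e0 wT.
pose I t := \int[mu]_(s in `[0, t]) G s (X s w).
pose J t := ht t xT / ht 0 x0 * expR (- I t) / (h t xT / q).
have eJ : \forall t \near T^'-, J t = D t w / (h t (X t w) / q).
  near=> t.
  have tT : t < T by near: t; exact: nbhs_left_lt.
  have t0 : 0 < t by near: t; exact: nbhs_left_gt.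
  rewrite DE ?(ltW t0)// wT//.
  by rewrite tT andbT; near: t; apply: nbhs_left_gt; rewrite gtrBl.
have htcv : ht t xT @[t --> T^'-] --> (1 : R).
  have : expR (- (tlambda * (T - t))) @[t --> T^'-] --> expR (- (tlambda * (T - T))).
    apply: cvg_at_left_filter.
    apply: continuous_cvg; first exact: continuous_expR.
    apply: cvgN; apply: cvgM; first exact: cvg_cst.
    by apply: cvgB; [exact: cvg_cst | exact: cvg_id].
  rewrite subrr mulr0 oppr0 expR0; apply: cvg_trans; apply: near_eq_cvg.
  near=> t.
  have tT : t < T by near: t; exact: nbhs_left_lt.
  have t0 : 0 < t by near: t; exact: nbhs_left_gt.
  by rewrite /htilde (ltW t0) tT x0xT lexx subrr expr0 fact0 divr1 mul1r.
have Icv : I t @[t --> T^'-] --> I T.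
  exact: (integral_guiding_rate_cvg (lambda := lambda) T0 x0xT tlambda0 (right_c w) e0 wT).
have hcv := hitting_cvg T0 x0xT lambda_gt0 jumpX.
have : J t @[t --> T^'-] --> 1 / ht 0 x0 * expR (- I T) / (1 / q).
  apply: cvgM.
    apply: cvgM; first by apply: cvgM => //; exact: cvg_cst.
    apply: continuous_cvg; first exact: continuous_expR.
    exact: cvgN.
  apply: cvgV; first by rewrite mul1r invr_neq0// gt_eqF.
  by apply: cvgM => //; exact: cvg_cst.
have -> : 1 / ht 0 x0 * expR (- I T) / (1 / q) = q / ht 0 x0 * expR (- I T).
  by rewrite !mul1r invrK mulrC mulrA.
by apply: cvg_trans; apply: near_eq_cvg; apply: filterS eJ => t ->.
Unshelve. all: by end_near. Qed.

(** The ratio htilde / h and the exponential factor are bounded separately. The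
    implication H_t = 0 -> D_t = 0 is what makes the guided law absolutely
    continuous with respect to the conditioned law on the past of t. *)
Lemma density_le : exists C e, [/\ 0 < C, 0 < e & forall t w, 0 < t -> T - e < t < T ->
  (h t (X t w) / q = 0 -> D t w = 0) /\
  `|D t w / (h t (X t w) / q)| <= C].
Proof.
have [C [e [C0 e0 bnd]]] :=
  htilde_le_hitting T x0xT lambda_gt0 tlambda0 jumpX.
pose K := expR (guiding_gap lambda tlambda x0 xT * T).
exists (C * q / ht 0 x0 * K), e; split=> //.
  by rewrite mulr_gt0 ?expR_gt0// divr_gt0// mulr_gt0.
move=> t w t0 tin; have /andP[_ tT] := tin.
have tin' : 0 <= t < T by rewrite (ltW t0).
have K0 : 0 <= C * q / ht 0 x0 * K.
  by rewrite mulr_ge0 ?expR_ge0// divr_ge0 ?mulr_ge0// ltW.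
rewrite DE//.
have [xin|xout] := boolP (x0 <= X t w <= xT); last first.
  have -> : ht t (X t w) = 0 by rewrite /htilde (negbTE xout) andbF.
  by rewrite !mul0r normr0.
have [h0 hth] := bnd t (X t w) t0 tin xin.
split=> [/eqP|]; first by rewrite mulf_eq0 invr_eq0 (gt_eqF h0) (gt_eqF q0).
rewrite ger0_norm; last first.
  rewrite divr_ge0//; last by rewrite divr_ge0 ?(ltW h0) ?(ltW q0).
  by rewrite mulr_ge0 ?expR_ge0// divr_ge0 ?ht_ge0// ltW.
rewrite ler_pdivrMr; last exact: divr_gt0.
apply: (@le_trans _ _ (C * h t (X t w) / ht 0 x0 * K)).
  apply: ler_pM.
  - by rewrite divr_ge0 ?ht_ge0// ltW.
  - exact: expR_ge0.
  - by rewrite ler_wpM2r// invr_ge0 ltW.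
  rewrite ler_expR lerNl.
  exact: (integral_guiding_rate_ge T0 x0xT tlambda0 tlambda_le (right_c w)).
rewrite le_eqVlt; apply/orP; left; apply/eqP.
have cancel (a b c r k : R) : 0 < b -> r * a * c * k = r * b * c * k * (a / b).
  by move=> b0; field; rewrite gt_eqF.
exact: cancel.
Qed.

Section along_approach.
Variables (C e : R).
Hypothesis C0 : 0 < C.
Hypothesis e0 : 0 < e.
Hypothesis bnd : forall t w, 0 < t -> T - e < t < T ->
  (h t (X t w) / q = 0 -> D t w = 0) /\ `|D t w / (h t (X t w) / q)| <= C.

(** A sequence of times serves to get a single exceptional null set for all the
    densities. *)
Let tk := approach T e.
Let E k : Omega -> \bar R :=
  'd (charge_of_finite_measure (on_past X Pcirc (tk k)))
  '/d (on_past X Pstar (tk k)).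

Let tk_gt0 k : 0 < tk k. Proof. by have /andP[] := approach_lt T0 e0 k. Qed.
Let tk_lt k : tk k < T. Proof. by have /andP[] := approach_lt T0 e0 k. Qed.
Let tk_in k : 0 <= tk k <= T. Proof. by rewrite !ltW. Qed.
Let tk_near k : T - e < tk k < T.
Proof. by rewrite tk_lt andbT; exact: approach_gt. Qed.

Let guided_on k : on_past X Pcirc (tk k) `<< on_past X P (tk k) /\
  ae_eq (on_past X P (tk k)) setT
    ('d (charge_of_finite_measure (on_past X Pcirc (tk k)))
     '/d (on_past X P (tk k))) (fun w => (D (tk k) w)%:E).
Proof. by apply: (proj1 guidedX); rewrite (ltW (tk_gt0 k)) tk_lt. Qed.

Let mH k : measurable_fun setT
  (fun w : g_sigma_algebraType (past X (tk k)) => h (tk k) (X (tk k) w) / q).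
Proof.
exact: (@measurable_state_fun _ _ _ X (fun x => h (tk k) x / q) _
  (ltW (tk_gt0 k))).
Qed.

Let H0 k w : 0 <= h (tk k) (X (tk k) w) / q.
Proof. by rewrite divr_ge0 ?hitting_ge0// ltW. Qed.

Let PstarH k A : <<s past X (tk k) >> A -> on_past X Pstar (tk k) A =
  (\int[on_past X P (tk k)]_(w in A) (h (tk k) (X (tk k) w) / q)%:E)%E.
Proof. exact: (conditioned_density T0 x0xT lambda_gt0 jumpX). Qed.

Let H_D k w : h (tk k) (X (tk k) w) / q = 0 -> D (tk k) w = 0.
Proof. exact: (bnd w (tk_gt0 k) (tk_near k)).1. Qed.

Let dom k : on_past X Pcirc (tk k) `<< on_past X Pstar (tk k).
Proof.
have [PcP PcD] := guided_on k.
exact: (dominates_density (@mH k) (H0 k) (@PstarH k) PcP PcD (@H_D k)).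
Qed.

Let EE k : {ae on_past X Pstar T, forall w,
  E k w = (D (tk k) w / (h (tk k) (X (tk k) w) / q))%:E}.
Proof.
apply: (ae_on_past_le (ltW (tk_lt k))).
have [PcP PcD] := guided_on k.
have := density_quotient (@mH k) (H0 k) (@PstarH k) PcP PcD (@H_D k).
by apply: filterS => w /(_ I).
Qed.

Let E_bnd : {ae on_past X Pstar T, forall w, forall k, (`|E k w| <= C%:E)%E}.
Proof.
apply: ae_foralln => k; have := EE k; apply: filterS => w ->.
by rewrite lee_fin; exact: (bnd w (tk_gt0 k) (tk_near k)).2.
Qed.

Let mE k : measurable_fun (setT : set (g_sigma_algebraType (past X (tk k)))) (E k).
Proof.
by apply: measurable_int; apply: Radon_Nikodym_integrable; exact: dom.
Qed.

Let mET k : measurable_fun (setT : set (g_sigma_algebraType (past X T))) (E k).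
Proof. exact: (measurable_on_past_le (ltW (tk_lt k)) (@mE k)). Qed.

Let PcircE k A : <<s past X (tk k) >> A ->
  Pcirc A = (\int[on_past X Pstar T]_(w in A) E k w)%E.
Proof.
move=> pA; rewrite -(integral_on_past_le _ (ltW (tk_lt k)) (@mE k) pA).
exact: (@Radon_Nikodym_integral _ _ _
  (charge_of_finite_measure (on_past X Pcirc (tk k))) _ A (@dom k) pA).
Qed.

Let Pcirc_le k A : <<s past X (tk k) >> A -> (Pcirc A <= C%:E * Pstar A)%E.
Proof.
move=> pA; have pAT := past_le (ltW (tk_lt k)) pA.
rewrite (PcircE pA).
have mEA : measurable_fun (A : set (g_sigma_algebraType (past X T))) (E k).
  exact: measurable_funTS (@mET k).
have := le_abse_integral (on_past X Pstar T) pAT mEA.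
move=> /(le_trans (lee_abs _)) /le_trans; apply.
apply: (@integral_le_bound _ _ _ (on_past X Pstar T) A (E k) C%:E pAT mEA).
  by rewrite lee_fin ltW.
have := E_bnd; apply: filterS => w + _; exact.
Qed.

(** A path has a left limit at T. If it is x <> xT then X_(t_k) = x from some k
    on, an event whose probability is at most that of X_(t_k) = x for every
    large k. *)
Let ends_at_target (Q : probability Omega R) :
  (forall x eps, x != xT -> 0 < eps ->
     \forall k \near \oo, (Q (X (tk k) @^-1` [set x]) <= eps%:E)%E) ->
  {ae on_past X Q T, forall w, \forall s \near T^'-, X s w = xT}.
Proof.
move=> small.
have null x : x != xT ->
    {ae on_past X Q T, forall w, ~ \forall k \near \oo, X (tk k) w = x}.
  move=> xxT.
  pose B N := \bigcap_(k in [set k | (N <= k)%N]) X (tk k) @^-1` [set x].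
  have pB N : <<s past X T >> (B N).
    apply: (@bigcap_measurable _ (g_sigma_algebraType (past X T))).
      by exists N => /=.
    by move=> k _; apply: past_state; exact: tk_in.
  have B0 N : Q (B N) = 0%E.
    apply/eqP; rewrite -measure_le0; apply/lee_addgt0Pr => eps eps0.
    rewrite add0e; have [K _ hK] := small x eps xxT eps0.
    apply: le_trans (hK (maxn N K) (leq_maxr _ _)).
    apply: le_measure; rewrite ?inE.
    - exact: past_measurable (pB N).
    - exact: measurable_state.
    - by apply: bigcap_inf; exact: leq_maxl.
  have [Z [mZ Z0 BZ]] : (on_past X Q T).-negligible (\bigcup_N B N).
    apply: negligible_bigcup => N.
    by exists (B N); split => //; [exact: pB | exact: B0].
  exists Z; split => // w /= /contrapT[N _ hN].
  by apply: BZ; exists N => // k Nk; exact: hN.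
have {}null : {ae on_past X Q T, forall w, forall n x, unpickle n = Some x ->
    x != xT -> ~ \forall k \near \oo, X (tk k) w = x}.
  apply: ae_foralln => n; case: (unpickle n) => [x|]; last exact: aeW.
  have [->|xxT] := eqVneq x xT.
    by apply: aeW => w y [<-]; rewrite eqxx.
  by apply: filterS (null x xxT) => w hw y [<-] _.
apply: filterS null => w hw.
have [x wx] := jump_left jumpX w T0.
have [xE|xxT] := eqVneq x xT; first by rewrite -xE.
case: (hw (pickle x) x (pickleK x) xxT).
exact: (approach_cvg T0 e0 wx).
Qed.

Let Pstar_small x eps : x != xT -> 0 < eps ->
  \forall k \near \oo, (Pstar (X (tk k) @^-1` [set x]) <= eps%:E)%E.
Proof.
move=> xxT eps0.
exact: (approach_cvg T0 e0
  (conditioned_state_small T0 x0xT lambda_gt0 jumpX xxT eps0)).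
Qed.

Let Pstar_ends : {ae on_past X Pstar T, forall w, \forall s \near T^'-, X s w = xT}.
Proof. exact: ends_at_target Pstar_small. Qed.

Let Pcirc_ends : {ae on_past X Pcirc T, forall w, \forall s \near T^'-, X s w = xT}.
Proof.
apply: ends_at_target => x eps xxT eps0.
have : 0 < eps / C by rewrite divr_gt0.
move=> /(Pstar_small xxT); apply: filterS => k hk.
have pA : <<s past X (tk k) >> (X (tk k) @^-1` [set x]).
  by apply: past_state; rewrite lexx ltW.
apply: (le_trans (Pcirc_le pA)).
apply: (@le_trans _ _ (C%:E * (eps / C)%:E)%E).
  by apply: lee_wpmul2l => //; rewrite lee_fin ltW.
by rewrite -EFinM mulrC divfK ?gt_eqF.
Qed.

Let pT : <<s past X T >> (X T @^-1` [set xT]).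
Proof. by apply: past_state; rewrite lexx ltW. Qed.

(** The guided law gives X_T the value of the left limit, which is xT. *)
Let Pcirc_target : {ae on_past X Pcirc T, forall w, X T w = xT}.
Proof.
have : {ae Pcirc, forall w, X T w = xT}.
  apply: filterS2 (ae_on_past Pcirc_ends) (proj2 guidedX) => w w1 w2.
  have [s [<- <-]] // : exists s, X s w = xT /\ X s w = X T w.
  exact: (@filter_ex _ T^'- _ _ (filterI w1 w2)).
move=> /negligibleP => /(_ _) N0.
exists (~` (X T @^-1` [set xT])); split => //.
  exact: (@measurableC _ (g_sigma_algebraType (past X T))).
by apply: N0; apply: measurableC; exact: measurable_state.
Qed.

Let Pstar_target : {ae on_past X Pstar T, forall w, X T w = xT}.
Proof.
exists (~` (X T @^-1` [set xT])); split => //.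
  exact: (@measurableC _ (g_sigma_algebraType (past X T))).
rewrite -[LHS]/(Pstar (~` (X T @^-1` [set xT]))).
rewrite (conditionedE T0 x0xT lambda_gt0 jumpX); last first.
  by apply: measurableC; exact: measurable_state.
by rewrite setICl measure0 mul0e.
Qed.

Let y w : R :=
  q / ht 0 x0 * expR (- \int[mu]_(s in `[0, T]) G s (X s w)).

Let E_cvg : {ae on_past X Pstar T, forall w, E k w @[k --> \oo] --> (y w)%:E}.
Proof.
have all_EE : {ae on_past X Pstar T, forall w, forall k,
    E k w = (D (tk k) w / (h (tk k) (X (tk k) w) / q))%:E}.
  exact: ae_foralln EE.
apply: filterS2 all_EE Pstar_ends => w Ew /near_left_ex[r r0 wT].
rewrite (_ : (fun k => E k w) = EFin \o
    (fun k => D (tk k) w / (h (tk k) (X (tk k) w) / q))); last first.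
  by apply/funext => k; rewrite Ew.
apply: cvg_EFin; first exact: nearW.
exact: (cvg_comp _ _ (approach_cvg T0 e0) (density_cvg r0 wT)).
Qed.

Let y_gt0 w : 0 < y w.
Proof. by rewrite mulr_gt0 ?expR_gt0// divr_gt0. Qed.

(** A pi-system generating the past of T: the guided law is described by its
    restrictions to the pasts of s < T, and the event X_T in B completes these. *)
Let events : set (set Omega) := [set A | exists s A' B,
  [/\ 0 <= s < T, <<s past X s >> A' & A = A' `&` X T @^-1` B]].

Let events_generate : <<s past X T >> = <<s events >>.
Proof.
apply/seteqP; split.
  apply: sub_sigma_algebra2 => _ [s /= + [B mB <-]].
  rewrite in_itv/= setTI [s <= T]le_eqVlt => /andP[s0 /predU1P[->|sT]].
    exists 0, setT, B; split; rewrite ?lexx ?setTI//.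
    exact: (@measurableT _ (g_sigma_algebraType (past X 0))).
  exists s, (X s @^-1` B), setT; split; rewrite ?s0 ?preimage_setT ?setIT//.
  by apply: past_state; rewrite s0 lexx.
apply: smallest_sub; first exact: smallest_sigma_algebra.
move=> _ [s [A [B [/andP[s0 sT] pA ->]]]]; apply: past_setI.
  exact: past_le (ltW sT) _ pA.
by apply: past_state; rewrite lexx ltW.
Qed.

Let events_setI : setI_closed events.
Proof.
move=> _ _ [s [A [B [/andP[s0 sT] pA ->]]]] [s' [A' [B' [/andP[s'0 s'T] pA' ->]]]].
exists (Num.max s s'), (A `&` A'), (B `&` B'); split.
- by rewrite le_max s0 gt_max sT s'T.
- by apply: past_setI; [apply: past_le pA | apply: past_le pA'];
    rewrite le_max lexx ?orbT.
- by rewrite preimage_setI setIACA.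
Qed.

Let events_setT : events setT.
Proof.
exists 0, setT, setT; split; rewrite ?lexx ?preimage_setT ?setIT//.
exact: (@measurableT _ (g_sigma_algebraType (past X 0))).
Qed.

Let integrableE k : (on_past X Pstar T).-integrable setT (E k).
Proof.
apply/integrableP; split; first exact: (@mET k).
have bound : (\int[on_past X Pstar T]_w `|E k w| <=
    C%:E * on_past X Pstar T setT)%E.
  apply: (@integral_le_bound _ _ _ (on_past X Pstar T) setT (E k) C%:E
    measurableT (@mET k)); first by rewrite lee_fin ltW.
  have := E_bnd; apply: filterS => w + _; exact.
by apply: (le_lt_trans bound); rewrite probability_setT mule1 ltry.
Qed.

(** Eventually t_k exceeds s, and then E k is a density on a sigma-algebra that
    contains the past of s. *)
Let PcE A : events A -> \forall k \near \oo,
  on_past X Pcirc T A = (\int[on_past X Pstar T]_(w in A) E k w)%E.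
Proof.
move=> [s [A' [B [/andP[s0 sT] pA ->]]]].
have : \forall k \near \oo, s < tk k.
  exact: (approach_cvg T0 e0 (nbhs_left_gt sT)).
apply: filterS => k sk.
have pAk : <<s past X (tk k) >> A' by apply: past_le pA; exact: ltW.
have pAT : <<s past X T >> A' by apply: past_le pA; exact: ltW.
have pB : <<s past X T >> (X T @^-1` B) by apply: past_state; rewrite lexx ltW.
have pI : <<s past X T >> (A' `&` X T @^-1` B) := past_setI pAT pB.
have mEI (F : set Omega) :
    measurable_fun (F : set (g_sigma_algebraType (past X T))) (E k).
  exact: measurable_funTS (@mET k).
(* almost surely X_T = xT under both laws, so it only
   matters whether B contains xT *)
pose N := ~` (X T @^-1` [set xT]).
have pN : <<s past X T >> N.
  exact: (@measurableC _ (g_sigma_algebraType (past X T))).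
have N0 (Q : probability Omega R) :
    {ae on_past X Q T, forall w, X T w = xT} -> on_past X Q T N = 0%E.
  move=> [Z [mZ Z0 TZ]].
  exact: (@subset_measure0 _ (g_sigma_algebraType (past X T)) _
    (on_past X Q T) _ _ pN mZ TZ Z0).
have PcircN F : <<s past X T >> F ->
    on_past X Pcirc T F = on_past X Pcirc T (F `\` N).
  move=> pF.
  rewrite [LHS](@measureDI _ (g_sigma_algebraType (past X T)) _
    (on_past X Pcirc T) F N pF pN).
  rewrite [X in (_ + X)%E](_ : _ = 0%E) ?adde0//.
  apply: (@subset_measure0 _ (g_sigma_algebraType (past X T)) _
    (on_past X Pcirc T) _ _ (past_setI pF pN) pN _ (N0 _ Pcirc_target)).
  exact: subIsetr.
have PstarN F : <<s past X T >> F -> (\int[on_past X Pstar T]_(w in F) E k w =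
    \int[on_past X Pstar T]_(w in F `\` N) E k w)%E.
  move=> pF; apply: (@negligible_integral _ (g_sigma_algebraType (past X T)) _
    (on_past X Pstar T) _ _ _ pN pF _ (N0 _ Pstar_target)).
  exact: integrableS (integrableE k).
rewrite (PcircN _ pI) (PstarN _ pI).
have [xB|xB] := pselect (B xT); last first.
  have -> : (A' `&` X T @^-1` B) `\` N = set0.
    rewrite -subset0 => w [[_ Bw]] /contrapT /= wT.
    by apply: xB; rewrite -wT.
  by rewrite measure0 integral_set0.
have -> : (A' `&` X T @^-1` B) `\` N = A' `\` N.
  apply/seteqP; split => w; first by move=> [[A'w _] Nw].
  by move=> [A'w Nw]; split => //; split => //=; have /contrapT /= -> := Nw.
rewrite -(PcircN _ pAT) -(PstarN _ pAT).
exact: PcircE.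
Qed.

Lemma conditioned_guided_density :
  [/\ on_past X Pstar T `<< on_past X Pcirc T,
      on_past X Pcirc T `<< on_past X Pstar T &
      ae_eq (on_past X Pcirc T) setT
        ('d (charge_of_finite_measure (on_past X Pstar T))
         '/d (on_past X Pcirc T)) (fun w => (y w)^-1%:E)] /\
  {ae on_past X Pcirc T, forall w, (\forall s \near T^'-, X s w = xT) /\ X T w = xT}.
Proof.
split; last by apply: filterS2 Pcirc_ends Pcirc_target.
apply: (@density_limit _ (g_sigma_algebraType (past X T)) R
  (on_past X Pcirc T) (on_past X Pstar T) events E y C events_generate
  (@events_setI) events_setT (fun k => @mET k) (@PcE) E_bnd E_cvg).
by apply: aeW => w; exact: y_gt0.
Qed.

End along_approach.

(** The density of the guided law vanishes with htilde outside the range. *)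
Lemma guided_state_in t : 0 <= t < T ->
  {ae on_past X Pcirc t, forall w, x0 <= X t w <= xT}.
Proof.
move=> tin; have [PcP PcD] := (proj1 guidedX) t tin.
have /andP[t0 tT] := tin.
pose A := X t @^-1` [set x | ~~ (x0 <= x <= xT)].
have pA : <<s past X t >> A by apply: past_state; rewrite t0 lexx.
exists A; split => //; last by move=> w /= /negP.
have -> : on_past X Pcirc t A = (\int[on_past X P t]_(w in A)
    ('d (charge_of_finite_measure (on_past X Pcirc t)) '/d (on_past X P t)) w)%E.
  exact: (@Radon_Nikodym_integral _ _ _
    (charge_of_finite_measure (on_past X Pcirc t)) _ A PcP pA).
rewrite (@ae_eq_integral _ (g_sigma_algebraType (past X t)) _ (on_past X P t) A
  (cst 0%E)) ?integral0//.
- apply: measurable_funTS; apply: measurable_int.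
  exact: (@Radon_Nikodym_integrable _ _ _
    (charge_of_finite_measure (on_past X Pcirc t)) _ PcP).
- have := PcD; apply: filterS => w /(_ I) -> /= /negbTE xout.
  by rewrite /guiding_density {1}/htilde xout andbF !mul0r.
Qed.

(** Almost sure statements at rational times extend to all times by right
    continuity. *)
Lemma guided_path_in : {ae on_past X Pcirc T, forall w,
  forall s, 0 <= s < T -> x0 <= X s w <= xT}.
Proof.
have rational n : {ae on_past X Pcirc T, forall w, forall r : rat,
    unpickle n = Some r -> 0 <= (ratr r : R) < T -> x0 <= X (ratr r) w <= xT}.
  case: (unpickle n) => [r|]; last exact: aeW.
  have [rT|rT] := boolP (0 <= (ratr r : R) < T); last first.
    by apply: aeW => w r' [<-] rT'; rewrite rT' in rT.
  have := guided_state_in rT; have /andP[_ /ltW le] := rT.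
  move=> /(ae_on_past_le le); apply: filterS => w hw r' [<-] _; exact: hw.
have {}rational := ae_foralln rational.
apply: filterS rational => w hw s /andP[s0 sT].
have [e e0 he] := near_right_ex (right_c w s0).
have sm : s < Num.min (s + e) T by rewrite lt_min ltrDl e0.
have [r] := rat_in_itvoo sm.
rewrite in_itv/= lt_min => /andP[sr /andP[re rT]].
rewrite -(he (ratr r)) ?sr//.
by apply: (hw (pickle r) r (pickleK r)); rewrite (le_trans s0) ?(ltW sr).
Qed.

(** On a path that stays in the range, including at time T itself, the
    integrand of the theorem is the guiding rate. *)
Lemma integral_on_path w : (forall s, 0 <= s < T -> x0 <= X s w <= xT) ->
  X T w = xT -> (\forall s \near T^'-, X s w = xT) ->
  (\int[mu]_(s in `[0%R, T])
     ((lambda (X s w) - tlambda) *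
      ((xT - X s w)%:~R / (tlambda * (T - s)) - 1))%:E)%E =
  (\int[mu]_(s in `[0, T]) G s (X s w))%:E.
Proof.
move=> win wT /near_left_ex[e e0 we].
have iG := integrable_guiding_rate lambda T0 x0xT tlambda0 (right_c w) e0 we.
rewrite /Rintegral fineK; last exact: integrable_fin_num iG.
apply: eq_integral => s; rewrite inE/= in_itv/= => /andP[s0 sT].
have xin : x0 <= X s w <= xT.
  move: sT; rewrite le_eqVlt => /predU1P[->|sT]; first by rewrite wT x0xT lexx.
  by apply: win; rewrite s0.
by rewrite /guiding_rate xin.
Qed.

Lemma hitting_start : h 0 x0 = q.
Proof.
rewrite /hitting (jump_start jumpX) divr1 /q.
have mX := measurable_state X; congr fine.
have start : P (~` (X 0 @^-1` [set x0])) = 0%E.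
  by rewrite probability_setC// (jump_start jumpX) subee.
have null : P (X T @^-1` [set xT] `\` X 0 @^-1` [set x0]) = 0%E.
  apply: (subset_measure0 (mu := P) _ _ _ start).
  - exact: measurableD.
  - exact: measurableC.
  - by move=> w [].
rewrite [RHS](measureDI P (mX T xT) (mX 0 x0)).
by rewrite [X in (X + _)%E](_ : _ = 0%E) ?add0e//; exact: null.
Qed.

End guided_versus_conditioned.

Theorem theorem4p2 (R : realType) (d : measure_display)
    (Omega : measurableType d) (P Pcirc : probability Omega R)
    (X : R -> {mfun Omega >-> int}) (lambda : int -> R) (tlambda T : R)
    (x0 xT : int) :
  0 < T -> x0 < xT -> 0 < tlambda ->
  (forall x, x0 <= x <= xT -> 0 <= lambda x) ->
  jump_process X P lambda x0 ->
  guided X P lambda (htilde T tlambda x0 xT) x0 T Pcirc ->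
  (forall x, x0 <= x <= xT -> tlambda <= lambda x) ->
  let Pstar := conditioned X P T xT in
  let PstarT := on_past X Pstar T in
  let PcircT := on_past X Pcirc T in
  [/\ PstarT `<< PcircT, PcircT `<< PstarT &
    ae_eq PcircT setT
      ('d (charge_of_finite_measure PstarT) '/d PcircT)
      (fun w =>
        (htilde T tlambda x0 xT 0 x0 / hitting X P T xT 0 x0)%:E *
        expeR (\int[lebesgue_measure]_(s in `[0%R, T])
          ((lambda (X s w) - tlambda) *
           ((xT - X s w)%:~R / (tlambda * (T - s)) - 1))%:E))%E].
Proof.
move=> T0 /ltW x0xT tlambda0 _ jumpX guidedX tlambda_le Pstar PstarT PcircT.
have [C [e [C0 e0 bnd]]] := density_le T0 x0xT tlambda0 jumpX tlambda_le.
have [[starcirc circstar dE] ends] :=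
  conditioned_guided_density T0 x0xT tlambda0 jumpX guidedX tlambda_le C0 e0 bnd.
split=> //.
have inside := guided_path_in jumpX guidedX.
apply: filterS3 dE ends inside => w /(_ I) -> [wend wT] win _.
rewrite (integral_on_path T0 x0xT tlambda0 jumpX win wT wend) /= -EFinM.
rewrite (hitting_start T xT jumpX); congr EFin.
by rewrite invfM invf_div expRN invrK.
Qed.
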